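(* Let $\kappa\in\mathbb Z_+$ and $\eta\in\{2,3,\ldots\}\cup\{\infty\}$, and let $X=X_{\eta,\kappa}$ and $\phi=\phi_{\eta,\kappa}$ be the set and self-map described in the context. Then there exists a discrete measure $\mu$ on $X$ such that the composition operator $C_\phi$ in $L^2(\mu)$ has the property that $\mathcal D^\infty(C_\phi)$ is dense in $L^2(\mu)$ and the following conditions hold: (i) $\{\mathsf h_{\phi^n}(x_\kappa)\}_{n=0}^\infty$ is an H-determinate Stieltjes moment sequence with index of H-determinacy at $0$ equal to $0$, (ii) for all $i\in J_\eta$ and $j\in\mathbb N$, $\{\mathsf h_{\phi^n}(x_{i,j})\}_{n=0}^\infty$ is an H-determinate Stieltjes moment sequence with infinite index of H-determinacy; in particular, $\{\mathsf h_{\phi^n}(x_{i,1})\}_{n=0}^\infty$ is a Stieltjes moment sequence for every $i\in J_\eta$, (iii) there exists a unique family $\{P(x_{i,1},\cdot)\}_{i\in J_\eta}$ of Borel probability measures on $\mathbb R_+$ that satisfies the following three conditions: (i-b) for every $i\in J_\eta$, $P(x_{i,1},\cdot)$ is an S-representing measure of $\{\mathsf h_{\phi^n}(x_{i,1})\}_{n=0}^\infty$ vanishing on $[0,1]$, (i-c) $\sum_{i=1}^{\eta}\frac{\mu(x_{i,1})}{\mu(x_r)}\int_0^\infty\frac{t^r-1}{t^{\kappa+1}-1}P(x_{i,1},dt)+\frac{\mu(x_0)}{\mu(x_r)}=1$ for every $r\in J_\kappa$, (i-d$'$) $\sum_{i=1}^{\eta}\mu(x_{i,1})\int_0^\infty\frac{1}{t^{\kappa+1}-1}P(x_{i,1},dt)<\infty$;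 this family does not satisfy the condition (i-d) $\sum_{i=1}^{\eta}\frac{\mu(x_{i,1})}{\mu(x_0)}\int_0^\infty\frac{1}{t^{\kappa+1}-1}P(x_{i,1},dt)\le1$, (iv) there is no family $\{P'(x,\cdot)\}_{x\in X}$ of Borel probability measures on $\mathbb R_+$ that satisfies the consistency condition (CC), (v) if $\kappa=0$, then $C_\phi$ generates Stieltjes moment sequences.
   Context: Notation: $\mathbb N=\{1,2,\ldots\}$, $\mathbb Z_+=\{0,1,2,\ldots\}$, $\mathbb R_+=[0,\infty)$, $J_k=\{i\in\mathbb N:i\le k\}$ for $k\in\mathbb Z_+\cup\{\infty\}$ ($J_0=\emptyset$, $J_\infty=\mathbb N$); $0^0=1$; $\int_0^\infty$ means $\int_{[0,\infty)}$. All measures are positive. Integrals with denominator $t^{\kappa+1}-1$ are taken with respect to measures vanishing on $[0,1]$, i.e. effectively over $(1,\infty)$. The set and the symbol. $X=X_{\eta,\kappa}=\{x_0,\ldots,x_\kappa\}\cup\{x_{i,j}:i\in J_\eta,\ j\in\mathbb N\}$, all listed points being distinct, and $\phi=\phi_{\eta,\kappa}\colon X\to X$ is given by $\phi(x_{i,j})=x_{i,j-1}$ for $i\in J_\eta$, $j\ge2$; $\phi(x_{i,1})=x_\kappa$ for $i\in J_\eta$; $\phi(x_0)=x_\kappa$; $\phi(x_r)=x_{r-1}$ for $r\in J_\kappa$. Operators. A discrete measure on a nonempty set $X$ is a $\sigma$-finite measure $\mu$ on $2^X$ with $\mu(x):=\mu(\{x\})>0$ for all $x\in X$ (so $\mu(x)<\infty$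 as well). The composition operator $C_\phi$ in $L^2(\mu)$ has domain $\{f\in L^2(\mu):f\circ\phi\in L^2(\mu)\}$ and $C_\phi f=f\circ\phi$. For $n\in\mathbb Z_+$, $\mathsf h_{\phi^n}(x)=\mu((\phi^n)^{-1}(\{x\}))/\mu(x)\in[0,\infty]$. For an operator $A$ in a Hilbert space, $\mathcal D^\infty(A)=\bigcap_{n\ge0}\mathcal D(A^n)$; $A$ generates Stieltjes moment sequences if $\mathcal D^\infty(A)$ is dense and $\{\|A^nf\|^2\}_{n=0}^\infty$ is a Stieltjes moment sequence for every $f\in\mathcal D^\infty(A)$. Consistency condition. A family $\{P(x,\cdot)\}_{x\in X}$ of Borel probability measures on $\mathbb R_+$ satisfies (CC) if $\frac1{\mu(x)}\sum_{y\in\phi^{-1}(\{x\})}\mu(y)P(y,\sigma)=\int_\sigma t\,P(x,dt)$ for every Borel $\sigma\subseteq\mathbb R_+$ and every $x\in\phi(X)$. Moments. Let $\mathscr M$ be the set of Borel measures $\nu$ on $\mathbb R$ with $\int|t|^n\,d\nu<\infty$ for all $n\in\mathbb Z_+$, and $\mathscr M^+$ the set of those $\nu\in\mathscr M$ with closed support in $\mathbb R_+$ (Borel measures on $\mathbb R_+$ are identified with Borel measures on $\mathbb R$ supported in $\mathbb R_+$). A real sequence $\{\gamma_n\}_{n=0}^\infty$ is a Hamburger (resp. Stieltjes) moment sequence if there is $\nu\in\mathscr M$ (resp. $\mathscr M^+$) with $\gamma_n=\int t^n\,d\nu(t)$ for all $n\in\mathbb Z_+$; such $\nu$ are its H-representing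 (resp. S-representing) measures. It is H-determinate if it has exactly one H-representing measure; a measure in $\mathscr M$ is H-determinate if its moment sequence is. The index of H-determinacy of an H-determinate measure $\rho$ at $z\in\mathbb C$ is $\mathrm{ind}_z(\rho)=\sup\{k\in\mathbb Z_+:|t-z|^{2k}d\rho(t)\text{ is H-determinate}\}$. The index of an H-determinate moment sequence is that of its unique H-representing measure; it has infinite index of H-determinacy if its index is $\infty$ at some (equivalently, every) $z\in\mathbb C$. *)

(* Defs.v *)
From HB Require Import structures.
From mathcomp Require Import all_boot all_order all_algebra.
From mathcomp Require Import complex.
From mathcomp Require Import all_classical all_reals all_analysis.
From mathcomp Require Import measurable_realfun.

Set Implicit Arguments.
Unset Strict Implicit.
Unset Printing Implicit Defensive.

Import Order.TTheory GRing.Theory Num.Theory.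
Import numFieldNormedType.Exports.
Import ComplexField.Normc.

Local Open Scope classical_set_scope.
Local Open Scope ring_scope.

(* [None] stands for [eta = oo].  The index set [{1, ..., eta}] is shifted
   down by one. *)
Definition branch_index (eta : option nat) : Type :=
  {i : nat | oapp (fun k => (i < k)%N) true eta}.

HB.instance Definition _ (eta : option nat) :=
  Countable.copy (branch_index eta) {i : nat | oapp (fun k => (i < k)%N) true eta}.

(* [Circ r] is [x_r] for [0 <= r <= kappa]; [Branch i j] is [x_{i+1,j+1}]:
   both indices are shifted down by one. *)
Inductive vertex (kappa : nat) (eta : option nat) : Type :=
| Circ of 'I_kappa.+1
| Branch of branch_index eta & nat.

Arguments Circ {kappa eta}.
Arguments Branch {kappa eta}.

Section vertex_structures.
Context {kappa : nat} {eta : option nat}.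
Local Notation X := (vertex kappa eta).

Definition vertex_code (x : X) : 'I_kappa.+1 + branch_index eta * nat :=
  match x with Circ r => inl r | Branch i j => inr (i, j) end.

Definition vertex_decode (s : 'I_kappa.+1 + branch_index eta * nat) : X :=
  match s with inl r => Circ r | inr (i, j) => Branch i j end.

Lemma vertex_codeK : cancel vertex_code vertex_decode.
Proof. by case. Qed.

HB.instance Definition _ := Countable.copy X (can_type vertex_codeK).
HB.instance Definition _ := isPointed.Build X (Circ ord0).
HB.instance Definition _ := @isMeasurable.Build default_measure_display
  X discrete_measurable discrete_measurable0
  discrete_measurableC discrete_measurableU.

(* [phi x_{i,j} = x_{i,j-1}] ([j >= 2]), [phi x_{i,1} = phi x_0 = x_kappa]
   and [phi x_r = x_{r-1}] ([1 <= r <= kappa]). *)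
Definition phi (x : X) : X :=
  match x with
  | Circ r => if val r is r'.+1 then Circ (inord r') else Circ ord_max
  | Branch i j => if j is j'.+1 then Branch i j' else Circ ord_max
  end.

End vertex_structures.

Section moments.
Context {R : realType}.
Local Notation borelR := (measurableTypeR R).
Implicit Types (nu rho : {measure set borelR -> \bar R}) (g : nat -> \bar R).

(* A [{measure set _ -> _}] is a function on all sets, so Leibniz equality
   would also compare the irrelevant values on non-measurable ones. *)
Definition measure_eq nu nu' :=
  forall A : set borelR, measurable A -> nu A = nu' A.

Definition closed_support nu : set R :=
  \bigcap_(F in [set F : set R | closed F /\ nu (~` F) = 0%E]) F.

Definition supported_on_Rplus nu := closed_support nu `<=` `[0, +oo[.

Definition finite_moments nu :=
  forall n : nat, (\int[nu]_t (`|t| ^+ n)%:E < +oo)%E.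

Definition moment nu (n : nat) : \bar R := (\int[nu]_t (t ^+ n)%:E)%E.

(* Sequences take values in the extended reals; having a representing measure
   forces them to be real. *)
Definition H_representing g nu :=
  finite_moments nu /\ forall n, g n = moment nu n.

Definition S_representing g nu :=
  [/\ finite_moments nu, supported_on_Rplus nu & forall n, g n = moment nu n].

Definition stieltjes_moment_sequence g := exists nu, S_representing g nu.

Definition H_determinate g :=
  exists nu, H_representing g nu /\
    forall nu', H_representing g nu' -> measure_eq nu nu'.

Definition H_determinate_measure nu :=
  finite_moments nu /\ H_determinate (moment nu).

Definition weight (z : R[i]) (k : nat) (t : borelR) : R :=
  normc (real_complex R t - z) ^+ (2 * k).

Lemma weight_ge0 z k t : 0 <= weight z k t.
Proof. by rewrite exprn_ge0// /normc; case: (_ - _) => a b; rewrite sqrtr_ge0. Qed.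

Lemma measurable_weight z k : measurable_fun setT (weight z k).
Proof.
rewrite /weight; case: z => a b; apply: measurable_funX => /=.
apply: (@measurableT_comp _ _ _ _ _ _ (@Num.sqrt R)).
  by apply: continuous_measurable_fun; exact: sqrt_continuous.
by apply: measurable_funD; apply: measurable_funX; apply: measurable_funB.
Qed.

(* The measure [|t - z| ^ 2k d rho(t)] *)
Definition weighted rho (z : R[i]) (k : nat) (A : set borelR) : \bar R :=
  (\int[rho]_(t in A) (weight z k t)%:E)%E.

Section weighted_measure.
Variables (rho : {measure set borelR -> \bar R}) (z : R[i]) (k : nat).

Let weighted0 : weighted rho z k set0 = 0%E.
Proof. exact: integral_set0. Qed.

Let weighted_ge0 A : (0 <= weighted rho z k A)%E.
Proof. by apply: integral_ge0 => t _; rewrite lee_fin weight_ge0. Qed.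

Let weighted_sigma_additive : semi_sigma_additive (weighted rho z k).
Proof.
apply: semi_sigma_additive_nng_induced.
- by apply/measurable_EFinP; exact: measurable_weight.
- by move=> t; rewrite lee_fin weight_ge0.
Qed.

HB.instance Definition _ := isMeasure.Build _ _ _ (weighted rho z k)
  weighted0 weighted_ge0 weighted_sigma_additive.

End weighted_measure.

Definition index_at (z : R[i]) rho : \bar R :=
  ereal_sup [set (k%:R)%:E | k in
    [set k : nat | H_determinate_measure (weighted rho z k)]].

(* [sequence_index g z m] is only used for H-determinate [g], whose
   H-representing measure is unique. *)
Definition sequence_index g (z : R[i]) (m : \bar R) :=
  exists2 rho, H_representing g rho & index_at z rho = m.

Definition infinite_index g := exists z : R[i], sequence_index g z +oo%E.

End moments.

Record operator (H : Type) := Operator { dom : set H; app :> H -> H }.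

Section composition_operators.
Context {R : realType} {kappa : nat} {eta : option nat}.
Local Notation X := (vertex kappa eta).
Local Notation borelR := (measurableTypeR R).
Variable mu : {measure set X -> \bar R}.

Definition discrete_measure :=
  sigma_finite setT mu /\ forall x, (0 < mu [set x])%E.

Definition L2norm (f : X -> R[i]) : \bar R :=
  ('N[mu]_2%:E[EFin \o @normc R \o f])%E.

(* All functions on [X] are measurable and, [mu] having no atom of measure 0,
   functions equal almost everywhere are equal: no quotient is needed. *)
Definition L2 : set (X -> R[i]) := [set f | (L2norm f < +oo)%E].

Definition dense_in_L2 (D : set (X -> R[i])) :=
  forall f, L2 f -> forall e : R, 0 < e ->
    exists2 g, D g & (L2norm (fun x => f x - g x)%R < e%:E)%E.

Fixpoint dom_power (A : operator (X -> R[i])) (n : nat) : set (X -> R[i]) :=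
  if n is n'.+1 then [set f | dom A f /\ dom_power A n' (A f)] else L2.

Definition dom_infty (A : operator (X -> R[i])) : set (X -> R[i]) :=
  \bigcap_n dom_power A n.

Definition generates_stieltjes (A : operator (X -> R[i])) :=
  dense_in_L2 (dom_infty A) /\
  forall f, dom_infty A f ->
    stieltjes_moment_sequence (fun n => (L2norm (iter n A f) ^+ 2)%E).

Definition composition_operator : operator (X -> R[i]) :=
  Operator [set f | L2 f /\ L2 (f \o phi)] (fun f => f \o phi).

(* The sequence [n |-> h_{phi^n}(x)] *)
Definition hseq (x : X) (n : nat) : \bar R :=
  (mu (iter n phi @^-1` [set x]) / mu [set x])%E.

Definition consistency_condition (P : X -> probability borelR R) :=
  forall (s : set borelR) (x : X), measurable s -> s `<=` `[0, +oo[ ->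
    range (@phi kappa eta) x ->
    ((mu [set x])^-1 * (\esum_(y in phi @^-1` [set x]) (mu [set y] * P y s))
      = \int[P x]_(t in s) t%:E)%E.

Implicit Types P : branch_index eta -> probability borelR R.

(* The common shape of the integrals in the conditions below; the measures
   used there vanish on [[0, 1]]. *)
Definition cyc_integral P (i : branch_index eta) (num : R -> R) : \bar R :=
  (\int[P i]_(t in `]1%R, +oo[) (num t / (t ^+ kappa.+1 - 1))%:E)%E.

Definition cond_b P := forall i,
  S_representing (hseq (Branch i 0)) (P i) /\ P i [set` `[0%R, 1%R]] = 0%E.

Definition cond_c P := forall r : 'I_kappa.+1, (0 < r)%N ->
  ((\esum_(i in [set: branch_index eta])
      (mu [set Branch i 0] / mu [set Circ r]
       * cyc_integral P i (fun t => t ^+ r - 1)%R))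
    + mu [set Circ ord0] / mu [set Circ r] = 1)%E.

Definition cond_d' P : Prop :=
  ((\esum_(i in [set: branch_index eta])
      (mu [set Branch i 0] * cyc_integral P i (fun=> 1%R))) < +oo)%E.

Definition cond_d P : Prop :=
  ((\esum_(i in [set: branch_index eta])
      (mu [set Branch i 0] / mu [set Circ ord0]
       * cyc_integral P i (fun=> 1%R))) <= 1)%E.

Definition family_bcd' P :=
  [/\ forall i, supported_on_Rplus (P i), cond_b P, cond_c P & cond_d' P].

End composition_operators.

(* Main.v *)
Require Import Defs.
From HB Require Import structures.
From mathcomp Require Import all_boot all_order all_algebra.
From mathcomp Require Import complex.
From mathcomp Require Import all_classical all_reals all_analysis.
From mathcomp Require Import measurable_realfun.
From mathcomp Require Import ring lra zify.

Set Implicit Arguments.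
Unset Strict Implicit.
Unset Printing Implicit Defensive.

Import Order.TTheory GRing.Theory Num.Theory.
Import numFieldNormedType.Exports.

Local Open Scope classical_set_scope.
Local Open Scope ring_scope.

(** The whole construction rests on two measures with the same moments:
    [sum_k w_k delta_(2 ^ k)] and [nu = sum_k v_k delta_(lam_k)], where
    [lam_k = a 2 ^ k] and [1 < a < 2]; here [a], [w] and [v] are [node_scale],
    [pow2_mass] and [lam_mass].  They are two orthogonality measures of the same
    Al-Salam-Carlitz polynomials; equality of moments ([eq_moments]) follows from
    a common three-term recurrence.  The first measure has an atom of mass 1 at
    the point 1, the second one lives on [(1, oo)].

    The atoms of [nu] are distributed among the branches.  Branch [i] is given
    masses such that the representing measure of its first vertex is the
    normalised restriction of [(t - t ^ (- kappa)) d nu] to its class of nodes,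
    and the circuit vertex [x_r] gets the mass [sum_k v_k lam_k ^ (r - kappa) - 1].
    A telescoping computation ([graph_measure_Circ]) shows that the sequence at
    [x_kappa] is, up to a factor, [sum_k v_k lam_k ^ n - 1].  Formally this is the
    moment sequence of [nu - delta_1], which is not positive; but by equality of
    moments it is also represented by [tau = sum_(k >= 1) w_k delta_(2 ^ k)].  The
    subtracted 1 makes [cond_d] fail ([branch_prob_not_d]), and a consistent
    family would have to charge the nodes [lam_k] with a total mass that is too
    large by the same 1 ([no_consistent_family]).  The circuit masses are positive
    when [a] is close to 2 ([lam_mass_neg_moment]).

    Determinacy comes from one criterion ([H_determinate_nodes]): if polynomials
    vanishing at more and more atoms of a measure tend to 0 in [L^2] while staying
    away from 0 off the atoms, then every measure with the same moments is carried
    by these atoms, and dropping one factor isolates each mass.  For the measures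
    here the masses decay like [2 ^ (- k ^ 2)], and each point of the progression
    that is not an atom gains a factor [4 ^ k] ([H_determinate_dyadic]).  The measure [tau] misses only the point 1,
    which is just enough since [a < 2]; each branch misses infinitely many nodes,
    which absorbs every power of [t], so its index is infinite.  On the other hand
    [t ^ 2 d tau] dominates the image under doubling of the first measure, which
    can be exchanged for the image of [nu] ([tail_mass_indeterminate]): the index
    of [tau] at 0 is 0.

    Finitely supported functions are in the domain of all powers since all fibres
    have finite measure, which gives density.  When [kappa = 0] every vertex is on
    a branch or equal to [x_kappa], so all sequences are Stieltjes moment
    sequences, and mixing their representing measures handles an arbitrary
    function ([generates_stieltjes_of_hseq]). *)

(** * Discrete measures and moments on the half-line *)

Section discrete.
Context {R : realType} d {T : measurableType d}.
Implicit Types (s : nat -> R) (x : nat -> T).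

(** The masses enter through [`|s k|] so that the definition asks for no proof of
    positivity; every use has [0 <= s k]. *)
Definition atomic_measure s x : {measure set T -> \bar R} :=
  mseries (fun k => mscale (NngNum (normr_ge0 (s k))) (dirac (x k))) 0.

Lemma atomic_measureE s x (A : set T) : (forall k, 0 <= s k) ->
  atomic_measure s x A = (\sum_(k <oo) (s k * \1_A (x k))%:E)%E.
Proof.
move=> s0; rewrite /atomic_measure /= /mseries; apply: eq_eseriesr => k _.
change ((`|s k|%:E * \d_(x k) A)%E = (s k * \1_A (x k))%:E).
by rewrite ger0_norm// diracE EFinM indicE.
Qed.

Lemma ge0_integral_atomic_measure s x (f : T -> \bar R) : (forall k, 0 <= s k) ->
  measurable_fun setT f -> (forall t, (0 <= f t)%E) ->
  (\int[atomic_measure s x]_t f t = \sum_(k <oo) ((s k)%:E * f (x k)))%E.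
Proof.
move=> s0 mf f0; rewrite ge0_integral_measure_series//.
apply: eq_eseriesr => k _.
rewrite ge0_integral_mscale// integral_dirac// diracT mul1e.
by rewrite /= ger0_norm.
Qed.

Lemma atomic_measure_null s x (A : set T) : (forall k, 0 <= s k) ->
  (forall k, A (x k) -> s k = 0) -> atomic_measure s x A = 0%E.
Proof.
move=> s0 h; rewrite atomic_measureE// eseries0// => k _ _.
rewrite indicE; case: (boolP (x k \in A)); rewrite ?mulr0//.
by rewrite inE => /h ->; rewrite mul0r.
Qed.

End discrete.

Section half_line.
Context {R : realType}.
Local Notation borelR := (measurableTypeR R).
Implicit Types (nu : {measure set borelR -> \bar R}).

(** The complement of the closed support is a union of null open sets, and
    balls with rational data reduce this union to a countable one, so it is
    null itself. *)
Lemma supported_on_RplusP nu :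
  supported_on_Rplus nu <-> nu [set` `]-oo, (0:R)[] = 0%E.
Proof.
split=> [h|h]; last first.
  apply: bigcap_inf; split; first exact: interval_closed.
  suff -> : ~` [set` `[(0:R), +oo[] = [set` `]-oo, (0:R)[] by [].
  by apply/seteqP; split => t /=; rewrite !in_itv/= andbT ltNge => /negP.
pose B (p : rat * rat) : set R := ball (ratr p.1 : R) (ratr p.2).
pose F k : set R :=
  if unpickle k is Some p then if nu (B p) == 0%E then B p else set0 else set0.
apply: measure_negligible; first exact: measurable_itv.
have nF : nu.-negligible (\bigcup_k F k).
  apply: (@negligible_bigcup _ borelR R nu F) => k; rewrite /F; case: unpickle => [p|]; last first.
    exact: negligible_set0.
  case: eqP => [nB|_]; last exact: negligible_set0.
  by apply/negligibleP => //; exact: measurable_ball.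
apply: (negligibleS _ nF) => t /=; rewrite in_itv/= => t0.
have : ~ closed_support nu t.
  by move=> /h; rewrite /= in_itv/= andbT leNgt t0.
rewrite /closed_support => /existsNP[C]/= /not_implyP[[cC nC] Ct].
have oC : open (~` C) by exact: closed_openC.
have [c [r /= [tB BC]]] := open_subball_rat oC (mem_set Ct).
exists (pickle (c, r)); first exact: I.
rewrite /F pickleK.
have -> : nu (B (c, r)) = 0%E.
  apply: (@subset_measure0 _ _ _ nu _ (~` C)) => //.
  - exact: measurable_ball.
  - exact: open_measurable.
by rewrite eqxx; exact: set_mem tB.
Qed.


Lemma atomic_measure_Rplus (s x : nat -> R) : (forall k, 0 <= s k) -> (forall k, 0 <= x k) ->
  @atomic_measure R _ borelR s x [set` `]-oo, (0:R)[] = 0%E.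
Proof.
move=> s0 x0; apply: atomic_measure_null => // k /=.
by rewrite in_itv/= ltNge x0.
Qed.

Lemma measurable_fun_exprn n : measurable_fun setT (fun t : borelR => (t ^+ n)%:E).
Proof. by apply/measurable_EFinP; apply: measurable_funX; exact: measurable_id. Qed.

Lemma measurable_fun_normX n : measurable_fun setT (fun t : borelR => (`|t| ^+ n)%:E).
Proof.
by apply/measurable_EFinP; apply: measurable_funX; exact: normr_measurable.
Qed.

Lemma moment0 nu : moment nu 0 = nu setT.
Proof. by rewrite /moment; under eq_integral do rewrite expr0; rewrite integral_cst// mul1e. Qed.

(** On a measure carried by the half-line the signed integrand may be replaced
    by a nonnegative one, for which additivity and convergence need no
    integrability hypothesis. *)
Lemma moment_norm nu n : nu [set` `]-oo, (0:R)[] = 0%E ->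
  moment nu n = (\int[nu]_t (`|t| ^+ n)%:E)%E.
Proof.
move=> nu0; apply: ae_eq_integral => //.
- exact: measurable_fun_exprn.
- exact: measurable_fun_normX.
exists [set` `]-oo, (0:R)[]; split; [exact: measurable_itv|exact: nu0|].
move=> t /= ht; rewrite in_itv/= ltNge; apply/negP => t0; apply: ht => _.
by rewrite ger0_norm.
Qed.

Lemma moment_atomic_measure (s x : nat -> R) n : (forall k, 0 <= s k) -> (forall k, 0 <= x k) ->
  moment (@atomic_measure R _ borelR s x) n = (\sum_(k <oo) (s k * x k ^+ n)%:E)%E.
Proof.
move=> s0 x0; rewrite moment_norm ?atomic_measure_Rplus// ge0_integral_atomic_measure//.
- by apply: eq_eseriesr => k _; rewrite ger0_norm// EFinM.
- exact: measurable_fun_normX.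
Qed.

Lemma finite_moments_atomic_measure (s x : nat -> R) : (forall k, 0 <= s k) ->
  (forall k, 0 <= x k) ->
  (forall n, \sum_(k <oo) (s k * x k ^+ n)%:E < +oo)%E ->
  finite_moments (@atomic_measure R _ borelR s x).
Proof.
move=> s0 x0 h n; rewrite -moment_norm ?atomic_measure_Rplus//.
by rewrite moment_atomic_measure.
Qed.

Lemma moment_measure_add (m1 m2 : {measure set borelR -> \bar R}) n :
  m1 [set` `]-oo, (0:R)[] = 0%E -> m2 [set` `]-oo, (0:R)[] = 0%E ->
  moment (measure_add m1 m2) n = (moment m1 n + moment m2 n)%E.
Proof.
move=> h1 h2.
have h12 : measure_add m1 m2 [set` `]-oo, (0:R)[] = 0%E.
  by rewrite measure_addE h1 h2 adde0.
rewrite !moment_norm//.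
rewrite ge0_integral_measure_add//; exact: measurable_fun_normX.
Qed.

End half_line.

(** * A determinacy criterion for atomic measures *)

Section polynomial_integrals.
Context {R : realType}.
Local Notation borelR := (measurableTypeR R).
Implicit Types (nu : {measure set borelR -> \bar R}) (p : {poly R}).

Lemma measurable_horner p : measurable_fun setT (fun t : borelR => p.[t]).
Proof.
apply: (eq_measurable_fun (fun t : borelR => \sum_(i < size p) p`_i * t ^+ i)).
  by move=> t _; rewrite horner_coef.
apply: measurable_sum => i; apply: measurable_funM; first exact: measurable_cst.
by apply: measurable_funX; exact: measurable_id.
Qed.

Lemma integrable_exprn nu n : finite_moments nu ->
  nu.-integrable setT (fun t : borelR => (t ^+ n)%:E).
Proof.
move=> h; apply/integrableP; split; first exact: measurable_fun_exprn.
by under eq_integral do rewrite /= normrX; exact: h.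
Qed.

Lemma integral_horner nu p : finite_moments nu ->
  (\int[nu]_t p.[t]%:E = \sum_(i < size p) (p`_i)%:E * moment nu i)%E.
Proof.
move=> h.
transitivity (\int[nu]_t (\sum_(i < size p) (p`_i)%:E * (t ^+ i)%:E))%E.
  apply: eq_integral => t _; rewrite horner_coef -sumEFin.
  by apply: eq_bigr => i _; rewrite EFinM.
rewrite integral_sum//; last first.
  by move=> i; apply: integrableZl => //; exact: integrable_exprn.
apply: eq_bigr => i _; rewrite integralZl//; exact: integrable_exprn.
Qed.

Lemma eq_integral_horner nu nu' p : finite_moments nu -> finite_moments nu' ->
  moment nu =1 moment nu' ->
  (\int[nu]_t p.[t]%:E = \int[nu']_t p.[t]%:E)%E.
Proof.
by move=> h h' e; rewrite !integral_horner//; apply: eq_bigr => i _; rewrite e.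
Qed.

End polynomial_integrals.

(** Here [x] lists the possible atoms and [S] selects those that occur.  The
    polynomials [node_poly S N] vanish at more and more selected nodes and are
    normalised to be 1 at the origin. *)
Section atoms.
Context {R : realType}.
Local Notation borelR := (measurableTypeR R).
Implicit Types (nu : {measure set borelR -> \bar R}).
Variables (S : pred nat) (x : nat -> R).

Definition node_poly (P : pred nat) (N : nat) : {poly R} :=
  \prod_(j < N | P j) (1 - (x j)^-1 *: 'X).

Lemma horner_node_poly P N t :
  (node_poly P N).[t] = \prod_(j < N | P j) (1 - t / x j).
Proof.
rewrite horner_prod; apply: eq_bigr => j _.
by rewrite !hornerE mulrC.
Qed.

Definition nodes : set R := [set t | exists2 j, S j & x j = t].

Lemma measurable_nodes : measurable (nodes : set borelR).
Proof.
rewrite (_ : nodes = \bigcup_(j in [set j | S j]) [set x j]); last first.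
  by apply/seteqP; split => [t [j Sj <-]|t [j /= Sj ->]]; exists j.
by apply: bigcup_measurable => j _; exact: measurable_set1.
Qed.

Hypothesis x_inj : injective x.
(** Away from the selected nodes, and also at a selected node once its own
    factor is dropped, the products stay away from 0: they converge to the
    canonical product of an entire function with these zeros. *)
Hypothesis x_prod : forall t, exists2 c : R, 0 < c &
  forall N, c <= \prod_(j < N | S j && (x j != t)) `|1 - t / x j|.
Hypothesis x_sep : forall k, exists2 c : R, 0 < c &
  forall j, j != k -> c <= `|1 - x j / x k|.

(** The node polynomials tend to 0 in [L^2(nu)] along a subsequence. *)
Definition small_node_poly nu := forall (e : R) M, 0 < e -> exists2 N, (M <= N)%N &
  (\int[nu]_t ((node_poly S N ^+ 2).[t])%:E <= e%:E)%E.

Lemma horner_sqr_ge0 (p : {poly R}) t : 0 <= (p ^+ 2).[t].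
Proof. by rewrite horner_exp sqr_ge0. Qed.

(** On the set where all [node_poly S N] are at least [1 / m] in modulus,
    Markov's inequality bounds the measure by [m ^ 2] times an integral that
    can be made arbitrarily small; these sets exhaust the complement of the
    nodes. *)
Lemma not_nodes_null nu : small_node_poly nu -> nu (~` nodes) = 0%E.
Proof.
move=> small.
pose E m : set borelR :=
  \bigcap_N [set t : borelR | ((m.+1%:R^-1)^+2)%:E <= `|((node_poly S N ^+ 2).[t])%:E|]%E.
have mE m : measurable (E m).
  apply: bigcapT_measurable => N.
  rewrite -[X in measurable X]setTI.
  apply: emeasurable_fun_c_infty => //; apply: measurableT_comp => //.
  by apply/measurable_EFinP; exact: measurable_horner.
have nE m : nu (E m) = 0%E.
  apply/eqP; rewrite eq_le measure_ge0 andbT.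
  apply/lee_addgt0Pr => e e0; rewrite add0e.
  pose a : R := (m.+1%:R^-1)^+2.
  have a0 : 0 < a by rewrite exprn_gt0// invr_gt0.
  have [N _ hN] := small (a * e) 0%N (mulr_gt0 a0 e0).
  have mU : measurable_fun setT (fun t : borelR => ((node_poly S N ^+ 2).[t])%:E).
    by apply/measurable_EFinP; exact: measurable_horner.
  have := le_integral_abse nu measurableT mU a0.
  rewrite (eq_integral (fun t : borelR => ((node_poly S N ^+ 2).[t])%:E)); last first.
    by move=> t _; rewrite gee0_abs// lee_fin horner_sqr_ge0.
  move=> /le_trans/(_ hN).
  rewrite (EFinM a e) lee_pmul2l ?lte_fin//; apply: le_trans.
  apply: le_measure; rewrite ?inE//.
    apply: measurableI => //; rewrite -[X in measurable X]setTI.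
    by apply: emeasurable_fun_c_infty => //; apply: measurableT_comp.
  by move=> t /(_ N Logic.I)/= h; split.
apply: measure_negligible.
  by apply: measurableC; exact: measurable_nodes.
have nU : nu.-negligible (\bigcup_m E m).
  apply: (@negligible_bigcup _ borelR R nu E) => m.
  by apply/negligibleP; [exact: mE|exact: nE].
apply: (negligibleS _ nU) => t /= nt.
have [c c0 hc] := x_prod t.
have [m hm] : exists m : nat, m.+1%:R^-1 < c.
  by have [k] := @ltr_add_invr R 0 c c0; rewrite add0r; exists k.
exists m => // N _ /=.
rewrite lee_fin horner_exp normrX lerXn2r ?nnegrE ?invr_ge0//.
apply: (le_trans (ltW hm)); apply: (le_trans (hc N)).
rewrite horner_node_poly normr_prod.
rewrite le_eqVlt; apply/orP; left; apply/eqP; apply: eq_bigl => j.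
case Sj : (S j) => //=; apply/eqP => xj; apply: nt; by exists j.
Qed.


Lemma small_node_poly_eq nu nu' : finite_moments nu -> finite_moments nu' ->
  moment nu =1 moment nu' -> small_node_poly nu -> small_node_poly nu'.
Proof.
move=> h h' e sm eps M e0; have [N MN hN] := sm eps M e0.
by exists N => //; rewrite -(eq_integral_horner _ h h' e).
Qed.

Lemma measurable_sqr_node_poly P N (D : set borelR) :
  measurable_fun D (fun t : borelR => ((node_poly P N ^+ 2).[t])%:E).
Proof.
apply: measurable_funTS; apply/measurable_EFinP; exact: measurable_horner.
Qed.

(** Let [V] be [node_poly S N] without the factor of [x k].  Then [V ^ 2] is
    bounded below at [x k], while on the other nodes it is at most a constant
    times the square of [node_poly S N], whose integral is small.  So the
    integral of [V ^ 2], which depends only on the moments, determines the mass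
    of [x k] up to a small error. *)
Lemma atom_le nu nu' k : finite_moments nu -> finite_moments nu' ->
  moment nu =1 moment nu' -> small_node_poly nu -> S k ->
  (nu [set x k] <= nu' [set x k])%E.
Proof.
move=> h h' e sm Sk.
have sm' := small_node_poly_eq h h' e sm.
have [c c0 hc] := x_prod (x k).
have [a a0 ha] := x_sep k.
apply/lee_addgt0Pr => eps eps0.
have [N kN hN] := sm' (eps * (c ^+ 2 * a ^+ 2)) k.+1
  ltac:(by rewrite !mulr_gt0// exprn_gt0).
pose P := [pred j | S j & j != k].
pose V := node_poly P N; pose U := node_poly S N.
have UV t : U.[t] = V.[t] * (1 - t / x k).
  rewrite !horner_node_poly (bigD1 (Ordinal kN))//= [LHS]mulrC; congr (_ * _).
have Vk : c ^+ 2 <= (V ^+ 2).[x k].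
  rewrite horner_exp -[leRHS]ger0_norm ?sqr_ge0// normrX lerXn2r ?nnegrE ?(ltW c0)//.
  apply: (le_trans (hc N)); rewrite horner_node_poly normr_prod.
  rewrite le_eqVlt; apply/orP; left; apply/eqP; apply: eq_bigl => j /=.
  by rewrite (inj_eq x_inj).
have V0 : 0 < (V ^+ 2).[x k] by apply: lt_le_trans Vk; rewrite exprn_gt0.
have low : (((V ^+ 2).[x k])%:E * nu [set x k] <= \int[nu]_t ((V ^+ 2).[t])%:E)%E.
  rewrite -integral_cst; last exact: measurable_set1.
  rewrite (eq_integral (fun t : borelR => ((V ^+ 2).[t])%:E)); last first.
    by move=> t; rewrite inE => ->.
  apply: ge0_subset_integral => //; first exact: measurable_sqr_node_poly.
  by move=> t _; rewrite lee_fin horner_sqr_ge0.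
have up : (\int[nu']_t ((V ^+ 2).[t])%:E <=
    ((V ^+ 2).[x k])%:E * nu' [set x k] + (eps * c ^+ 2)%:E)%E.
  rewrite -(setvU [set x k]) setUC ge0_integral_setU//=; last 4 first.
  - exact: measurableC.
  - exact: measurable_sqr_node_poly.
  - by move=> t _; rewrite lee_fin horner_sqr_ge0.
  - by apply/disj_setPS => t [].
  apply: leeD.
    rewrite (eq_integral (fun _ : borelR => ((V ^+ 2).[x k])%:E)); last first.
      by move=> t; rewrite inE => ->.
    by rewrite integral_cst.
  have mD : measurable (~` [set x k] : set borelR) by exact: measurableC.
  apply: (@le_trans _ _ (\int[nu']_(t in ~` [set x k])
     ((a ^- 2)%:E * ((U ^+ 2).[t])%:E))%E).
    apply: ae_ge0_le_integral => //.
    - by move=> t _; rewrite lee_fin horner_sqr_ge0.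
    - exact: measurable_sqr_node_poly.
    - move=> t _; rewrite mule_ge0// lee_fin ?horner_sqr_ge0//.
      by rewrite invr_ge0 exprn_ge0// ltW.
    - apply: emeasurable_funM => //; exact: measurable_sqr_node_poly.
    exists (~` nodes); split.
    - by apply: measurableC; exact: measurable_nodes.
    - exact: not_nodes_null.
    move=> t /= ht -[j Sj xjt]; apply: ht => tk.
    rewrite -EFinM lee_fin !horner_exp UV exprMn.
    rewrite mulrCA ler_peMr ?sqr_ge0//.
    rewrite ler_pdivlMl ?exprn_gt0// mulr1.
    rewrite -[leRHS]ger0_norm ?sqr_ge0// normrX lerXn2r ?nnegrE ?(ltW a0)//.
    by rewrite -xjt; apply: ha; apply/eqP => jk; apply: tk; rewrite -xjt jk.
  apply: (@le_trans _ _ (\int[nu']_t ((a ^- 2)%:E * ((U ^+ 2).[t])%:E))%E).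
    apply: ge0_subset_integral => //.
      by apply: emeasurable_funM => //; exact: measurable_sqr_node_poly.
    move=> t _; rewrite mule_ge0// lee_fin ?horner_sqr_ge0//.
    by rewrite invr_ge0 exprn_ge0// ltW.
  rewrite ge0_integralZl//; last 3 first.
  - exact: measurable_sqr_node_poly.
  - by move=> t _; rewrite lee_fin horner_sqr_ge0.
  - by rewrite lee_fin invr_ge0 exprn_ge0// ltW.
  apply: (le_trans (lee_wpmul2l _ hN)).
    by rewrite lee_fin invr_ge0 exprn_ge0// ltW.
  rewrite -EFinM lee_fin le_eqVlt; apply/orP; left; apply/eqP.
  by field; rewrite gt_eqF.
have : (((V ^+ 2).[x k])%:E * nu [set x k] <=
  ((V ^+ 2).[x k])%:E * (nu' [set x k] + eps%:E))%E.
  apply: (le_trans low); rewrite (eq_integral_horner _ h h' e).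
  apply: (le_trans up); rewrite ge0_muleDr//; last by rewrite lee_fin ltW.
  by apply: leeD => //; rewrite -EFinM lee_fin mulrC ler_wpM2r// ltW.
by rewrite lee_pmul2l// lte_fin.
Qed.

(** Smallness of the integrals of the squared node polynomials is a property of
    the moments.  Hence every measure with the same moments is carried by the
    nodes and has the same atoms there. *)
Lemma H_determinate_nodes nu : finite_moments nu -> small_node_poly nu ->
  H_determinate (moment nu).
Proof.
move=> h sm; exists nu; split; first by [].
move=> nu' [h' e] A mA.
have e' : moment nu' =1 moment nu by move=> n; rewrite e.
have sm' := small_node_poly_eq h h' e sm.
have atom k : S k -> nu [set x k] = nu' [set x k].
  move=> Sk; apply/eqP; rewrite eq_le.
  by rewrite (atom_le h h' e sm Sk) (atom_le h' h e' sm' Sk).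
have mn := measurable_nodes.
pose F j : set borelR := A `&` [set x j].
have key rho : small_node_poly rho ->
    rho A = (\sum_(j <oo | j \in [set j | S j]) rho (F j))%E.
  move=> smr.
  have := not_nodes_null smr => nn.
  have AE : A = (\bigcup_(j in [set j | S j]) F j) `|` (A `&` ~` nodes).
    apply/seteqP; split => t.
      move=> At; have [[j Sj xj]|nt] := pselect (nodes t); last by right.
      by left; exists j.
    by case=> [[j _ []]|[]].
  rewrite {1}AE measureU0.
  - rewrite measure_bigcup//.
      by move=> j _; apply: measurableI => //; exact: measurable_set1.
    move=> i j _ _ [t [[_ /= ->] [_ /= /x_inj]]]; done.
  - apply: bigcup_measurable => j _.
    by apply: measurableI => //; exact: measurable_set1.
  - by apply: measurableI => //; exact: measurableC.
  - apply: (@subset_measure0 _ _ _ rho _ (~` nodes)) => //.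
    + by apply: measurableI => //; exact: measurableC.
    + exact: measurableC.
rewrite !key//; apply: eq_eseriesr => j; rewrite inE /= => Sj.
rewrite /F; case: (pselect (A (x j))) => [Axj|nAxj].
  by rewrite setIidr ?atom// => t ->.
by rewrite (_ : _ `&` _ = set0) ?measure0//; apply/seteqP; split => // t [+ tj]; rewrite tj.
Qed.

End atoms.

(** * Infinite products and geometric bounds *)

Section bounds.
Context {R : realType}.

(** Factors above 1 only help, so each is replaced by its minimum with 1.  From
    an index [J] on, the deficits [C / 2 ^ j] add up to at most 1/2, and the
    first [J] factors contribute a positive constant. *)
Lemma prod_bounded_below (f : nat -> R) (C : R) : (forall j, 0 < f j) ->
  (forall j, 1 - C / 2 ^+ j <= f j) ->
  exists2 c : R, 0 < c & forall N, c <= \prod_(j < N) f j.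
Proof.
move=> f0 fC; pose g j := Num.min 1 (f j).
have g0 j : 0 < g j by rewrite lt_min ltr01 f0.
have g1 j : g j <= 1 by rewrite ge_min lexx.
have p0 n (h : nat -> R) : (forall j, 0 < h j) -> 0 < \prod_(j < n) h j.
  by move=> h0; rewrite prodr_gt0.
have [J hJ] : exists J, `|C| * 4 <= 2 ^+ J.
  exists (Num.truncn (`|C| * 4)).+1; apply: (le_trans (ltW (truncnS_gt _))).
  by rewrite -natrX ler_nat ltnW// ltn_expl.
pose D := 2 * `|C| / 2 ^+ J.
have D0 : 0 <= D by rewrite divr_ge0// mulr_ge0.
have D2 : D <= 2^-1.
  by rewrite /D ler_pdivrMr ?exprn_gt0//; lra.
have tail n : 1 - D * (1 - (2 ^+ n)^-1) <= \prod_(j < n) g (J + j)%N.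
  elim: n => [|n ih]; first by rewrite big_ord0 expr0 invr1 subrr mulr0 subr0.
  rewrite big_ord_recr/=; set P := \prod_(_ < _) _ in ih *.
  have P1 : P <= 1 by apply: prodr_ile1 => i _; rewrite ltW ?g0//=.
  have P0 : 0 < P by exact: (p0 n (fun j => g (J + j)%N)).
  have gn : 1 - D / 2 ^+ n.+1 <= g (J + n)%N.
    rewrite le_min; apply/andP; split.
      by rewrite gerBl divr_ge0// exprn_ge0.
    apply: le_trans (fC _); rewrite lerD2l lerN2 /D exprD exprS.
    have -> : 2 * `|C| / 2 ^+ J / (2 * 2 ^+ n) = `|C| / (2 ^+ J * 2 ^+ n).
      by field; rewrite !expf_neq0.
    by rewrite ler_wpM2r ?ler_norm// invr_ge0 mulr_ge0// exprn_ge0.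
  have e0 : 0 <= D / 2 ^+ n.+1 by rewrite divr_ge0// exprn_ge0.
  have : P * (1 - D / 2 ^+ n.+1) <= P * g (J + n)%N by rewrite ler_pM2l.
  have : P * (D / 2 ^+ n.+1) <= D / 2 ^+ n.+1 by rewrite ler_piMl.
  have -> : D * (1 - (2 ^+ n.+1)^-1) = D * (1 - (2 ^+ n)^-1) + D / 2 ^+ n.+1.
    by rewrite exprS; field; rewrite expf_neq0.
  lra.
exists ((\prod_(j < J) g j) / 2); first by rewrite divr_gt0// (p0 J g).
move=> N; apply: (@le_trans _ _ (\prod_(j < N) g j)); last first.
  by apply: ler_prod => j _; rewrite ltW ?g0//= ge_min lexx orbT.
apply: (@le_trans _ _ (\prod_(j < N + J) g j)).
  rewrite addnC big_split_ord/= ler_pM2l ?(p0 J g)//.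
  apply: le_trans (tail N).
  have : 0 <= (2 ^+ N : R)^-1 by rewrite invr_ge0 exprn_ge0.
  nra.
rewrite big_split_ord/= ler_piMr ?(ltW (p0 N g g0))//.
by apply: prodr_ile1 => i _; rewrite ltW ?g0/=.
Qed.

Lemma geometric_le (u : nat -> R) (C e : R) : 0 <= e < 1 ->
  (forall k, 0 <= u k <= C * e ^+ k) -> (\sum_(k <oo) (u k)%:E <= (C / (1 - e))%:E)%E.
Proof.
move=> /andP[e0 e1] hu.
have C0 : 0 <= C by have /andP[] := hu 0%N; rewrite expr0 mulr1; exact: le_trans.
apply: lime_le; first by apply: is_cvg_nneseries => k _ _; rewrite lee_fin; case/andP: (hu k).
apply: nearW => n; rewrite sumEFin lee_fin.
apply: (@le_trans _ _ (\sum_(0 <= k < n) C * e ^+ k)).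
  by apply: ler_sum => k _; case/andP: (hu k).
rewrite -mulr_sumr ler_wpM2l// big_mkord.
have := subrX1 e n; rewrite -opprB -(opprB 1 e) mulNr => /oppr_inj h.
rewrite -[leLHS](@mulKf _ (1 - e)) ?gt_eqF ?subr_gt0// -h.
by rewrite mulrC -[leRHS]mul1r ler_wpM2r ?invr_ge0 ?subr_ge0 ?(ltW e1)// gerBl exprn_ge0.
Qed.

Lemma geometric_lty (u : nat -> R) (C e : R) : 0 <= e < 1 ->
  (forall k, 0 <= u k <= C * e ^+ k) -> (\sum_(k <oo) (u k)%:E < +oo)%E.
Proof. by move=> e01 hu; exact: le_lt_trans (geometric_le e01 hu) (ltry _). Qed.

End bounds.

(** * Determinacy on a dyadic progression *)

Section dyadic_nodes.
Context {R : realType}.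
Local Notation borelR := (measurableTypeR R).
Variables (b : R) (b0 : 0 < b).

Definition dyadic (k : nat) : R := b * 2 ^+ k.

Lemma dyadic_gt0 k : 0 < dyadic k.
Proof. by rewrite mulr_gt0// exprn_gt0. Qed.

Lemma dyadic_neq0 k : dyadic k != 0.
Proof. by rewrite gt_eqF// dyadic_gt0. Qed.

Lemma dyadic_inj : injective dyadic.
Proof.
move=> j k /(mulfI (lt0r_neq0 b0)).
by apply: ieexprIn; rewrite ?ltr0n// gt_eqF// ltr1n.
Qed.

Lemma dyadic_div j k : dyadic j / dyadic k = 2 ^+ j / 2 ^+ k.
Proof. by rewrite /dyadic; field; rewrite !lt0r_neq0 ?exprn_gt0. Qed.

Lemma dyadic_div_le i k : (i <= k)%N -> dyadic k / dyadic i = 2 ^+ (k - i).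
Proof.
by move=> ik; rewrite dyadic_div -{1}(subnK ik) exprD mulfK// lt0r_neq0 ?exprn_gt0.
Qed.

Lemma dyadic_prod (S : pred nat) (t : R) : exists2 c : R, 0 < c &
  forall N, c <= \prod_(j < N | S j && (dyadic j != t)) `|1 - t / dyadic j|.
Proof.
pose f j := if S j && (dyadic j != t) then `|1 - t / dyadic j| else 1.
have [] := @prod_bounded_below R f (`|t| / b).
- move=> j; rewrite /f; case: ifP => [/andP[_ jt]|]//.
  rewrite normr_gt0 subr_eq0 eq_sym; apply: contra jt => /eqP h.
  by rewrite -[t](@divfK _ (dyadic j)) ?dyadic_neq0// h mul1r.
- move=> j.
  have h : `|t| / b / 2 ^+ j = `|t / dyadic j|.
    by rewrite normrM normfV (gtr0_norm (dyadic_gt0 _)) /dyadic invfM mulrA.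
  rewrite h /f; case: ifP => _; last by rewrite gerBl.
  by apply: le_trans (lerB_normD _ _); rewrite normr1 normrN.
move=> c c0 hc; exists c => // N; rewrite big_mkcond/=; exact: hc.
Qed.

Lemma dyadic_sep k : exists2 c : R, 0 < c &
  forall j, j != k -> c <= `|1 - dyadic j / dyadic k|.
Proof.
exists 2^-1 => // j; rewrite neq_ltn => /orP[jk|kj].
  apply: le_trans (ler_norm _).
  have := @dyadic_div_le j k (ltnW jk) => h.
  have -> : dyadic j / dyadic k = (2 ^+ (k - j))^-1.
    by rewrite -h invf_div.
  have : (2 ^+ (k - j) : R)^-1 <= 2^-1.
    rewrite lef_pV2 ?posrE ?exprn_gt0// -[leLHS]expr1.
    by rewrite ler_weXn2l// ?ler1n ?subn_gt0.
  lra.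
rewrite distrC; apply: le_trans (ler_norm _).
rewrite dyadic_div_le 1?ltnW//.
have : (2:R) <= 2 ^+ (j - k).
  by rewrite -[leLHS]expr1 ler_weXn2l// ?ler1n ?subn_gt0.
lra.
Qed.

(** For [k >= N] each factor is at most [2 ^ (k - i)] in modulus, and every index
    [i] outside [S] saves such a factor.  With [M] indices missing below [L] the
    square of the polynomial is smaller than that of the full product by about
    [2 ^ (2 M k)], and the latter is at most [2 ^ (k ^ 2 + k)] because
    [2 k N <= k ^ 2 + N ^ 2 + (k - N)]. *)
Lemma node_poly_dyadic_bound (S : pred nat) (L N M k : nat) :
  (M <= \sum_(i < L) ~~ S i)%N -> (L <= N)%N -> (N <= k)%N ->
  ((node_poly dyadic S N) ^+ 2).[dyadic k] * 2 ^+ (2 * M * k)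
    <= 2 ^+ (k * k + k + 2 * L * M).
Proof.
move=> hM LN Nk.
rewrite horner_exp.
have : `|(node_poly dyadic S N).[dyadic k]| <= 2 ^+ (\sum_(i < N | S i) (k - i)).
  rewrite horner_node_poly normr_prod -prodrXr.
  apply: ler_prod => i _; rewrite normr_ge0/=.
  rewrite dyadic_div_le; last by rewrite ltnW// (leq_trans (ltn_ord i)).
  have : (1 : R) <= 2 ^+ (k - i) by rewrite exprn_ege1// ler1n.
  by move=> h; rewrite distrC ger0_norm ?subr_ge0// gerBl.
rewrite -(@ler_sqr R) ?nnegrE ?normr_ge0 ?exprn_ge0// -normrX ger0_norm ?sqr_ge0//.
rewrite -exprM => h.
apply: (le_trans (ler_wpM2r _ h)); first by rewrite exprn_ge0.
rewrite -exprD ler_weXn2l ?ler1n//.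
set eS := (\sum_(i < N | S i) (k - i))%N.
pose eN := (\sum_(i < N | ~~ S i) (k - i))%N.
have e1 : (eS + eN + \sum_(i < N) i = k * N)%N.
  rewrite /eS /eN -(bigID (fun i : 'I_N => S i) xpredT (fun i : 'I_N => (k - i)%N))/=.
  rewrite -big_split/= (eq_bigr (fun=> k)) ?sum_nat_const ?card_ord ?(mulnC k)//.
  by move=> i _; rewrite subnK// ltnW// (leq_trans (ltn_ord i)).
have e2 : (M * k <= eN + L * M)%N.
  have : (\sum_(i < L | ~~ S i) (k - i) <= eN)%N.
    rewrite /eN -(subnKC LN) big_split_ord/=; exact: leq_addr.
  have : (M * (k - L) <= \sum_(i < L | ~~ S i) (k - i))%N.
    apply: (@leq_trans (\sum_(i < L | ~~ S i) (k - L))); last first.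
      by apply: leq_sum => i _; rewrite leq_sub2l// ltnW.
    rewrite [leqRHS](eq_bigr (fun i : 'I_L => 1 * (k - L)))%N; last by move=> i _; rewrite mul1n.
    rewrite -big_distrl/= leq_mul2r; apply/orP; right.
    by rewrite [leqRHS]big_mkcond/=; apply: (leq_trans hM); apply: leq_sum => i _; case: (S i).
  have : (M * k = M * (k - L) + M * L)%N.
    by rewrite -mulnDr subnK// (leq_trans LN).
  rewrite (mulnC M L); lia.
have e3 : (2 * (\sum_(i < N) i) + N = N * N)%N.
  elim: {LN Nk eS eN e1 e2} N {h} => [|n ih]; first by rewrite big_ord0.
  rewrite big_ord_recr/= mulnDr mulSn mulnS; set T := (\sum_(i < n) i)%N in ih *; lia.
have e4 : (2 * k * N <= k * k + N * N + (k - N))%N.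
  have [d ->] : exists d, k = (N + d)%N by exists (k - N)%N; rewrite subnKC.
  nia.
nia.
Qed.


(** A Gaussian decay [2 ^ (- k ^ 2)] beats every geometric growth:
    [p k <= p ^ 2 + k ^ 2]. *)
Lemma gauss_summable (s : nat -> R) C m n : (forall k, 0 <= s k) ->
  (forall k, s k * 2 ^+ (k * k) <= C * 2 ^+ (m * k)) ->
  (\sum_(k <oo) (s k * dyadic k ^+ n)%:E < +oo)%E.
Proof.
move=> s0 sC; pose p := (m + n + 1)%N.
have C0 : 0 <= C by have := sC 0%N; rewrite !muln0 !expr0 !mulr1; exact: (le_trans (s0 0%N)).
apply: (@geometric_lty R _ (C * b ^+ n * 2 ^+ (p * p)) 2^-1).
  by rewrite invr_ge0 ler0n/= invf_lt1// ltr1n.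
move=> k; rewrite mulr_ge0 ?exprn_ge0 ?(ltW (dyadic_gt0 k))//=.
rewrite exprVn ler_pdivlMr ?exprn_gt0//.
rewrite -(@ler_pM2r _ (2 ^+ (k * k))) ?exprn_gt0//.
have -> : s k * dyadic k ^+ n * 2 ^+ k * 2 ^+ (k * k) =
   (s k * 2 ^+ (k * k)) * (b ^+ n * 2 ^+ (k * n + k)).
  by rewrite /dyadic exprMn -exprM exprD; ring.
apply: (le_trans (ler_wpM2r _ (sC k))).
  by rewrite mulr_ge0// exprn_ge0// ltW.
have -> : C * 2 ^+ (m * k) * (b ^+ n * 2 ^+ (k * n + k)) =
  C * b ^+ n * 2 ^+ (p * k).
  have -> : (p * k = m * k + (k * n + k))%N by rewrite /p; nia.
  by rewrite (exprD _ (m * k)%N); ring.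
have -> : C * b ^+ n * 2 ^+ (p * p) * 2 ^+ (k * k) =
  C * b ^+ n * 2 ^+ (p * p + k * k) by rewrite exprD; ring.
rewrite ler_wpM2l ?mulr_ge0 ?exprn_ge0 ?(ltW b0)//.
rewrite ler_weXn2l ?ler1n//; have := leq_total p k; nia.
Qed.

Lemma finite_moments_gauss (s : nat -> R) C m : (forall k, 0 <= s k) ->
  (forall k, s k * 2 ^+ (k * k) <= C * 2 ^+ (m * k)) ->
  finite_moments (@atomic_measure R _ borelR s dyadic).
Proof.
move=> s0 sC; apply: finite_moments_atomic_measure => //.
  by move=> k; rewrite ltW// dyadic_gt0.
by move=> n; exact: gauss_summable sC.
Qed.

(** The missing nodes make up for the growth allowed in the masses: by the two
    bounds the terms of the integral of the squared node polynomial vanish for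
    [k < N] and are [O(e ^ k)] for [k >= N]. *)
Lemma H_determinate_dyadic (s : nat -> R) (S : pred nat) C e M L :
  (forall k, 0 <= s k) -> (forall k, ~~ S k -> s k = 0) -> 0 <= e < 1 ->
  (forall k, s k * 2 ^+ (k * k + k) <= C * e ^+ k * 2 ^+ (2 * M * k)) ->
  (M <= \sum_(i < L) ~~ S i)%N ->
  finite_moments (@atomic_measure R _ borelR s dyadic) /\
  H_determinate (moment (@atomic_measure R _ borelR s dyadic)).
Proof.
move=> s0 sS e01 sC hM; have /andP[e0 e1] := e01.
have C0 : 0 <= C by have := sC 0%N; rewrite !muln0 !expr0 !mulr1; exact: (le_trans (s0 0%N)).
have fm : finite_moments (@atomic_measure R _ borelR s dyadic).
  apply: (@finite_moments_gauss _ C (2 * M)) => // k.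
  apply: (@le_trans _ _ (s k * 2 ^+ (k * k + k))).
    by rewrite ler_wpM2l// ler_weXn2l ?ler1n// leq_addr.
  apply: (le_trans (sC k)); rewrite ler_wpM2r ?exprn_ge0//.
  by rewrite ler_piMr// exprn_ile1// ltW.
split=> //; apply: (@H_determinate_nodes R S dyadic) => //.
- exact: dyadic_inj.
- exact: dyadic_prod.
- exact: dyadic_sep.
pose K := C * 2 ^+ (2 * L * M).
have K0 : 0 <= K by rewrite mulr_ge0// exprn_ge0.
have geo0 k : (0 <= (K * e ^+ k)%:E)%E by rewrite lee_fin mulr_ge0// exprn_ge0.
have sumK : (\sum_(k <oo) (K * e ^+ k)%:E < +oo)%E.
  by apply: (@geometric_lty R _ K e) => // k; rewrite -lee_fin geo0/=.
move=> eps N0 eps0.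
have := nneseries_tail_cvg sumK (fun k _ => geo0 k).
move=> /fine_cvgP[fin /cvgrPdist_lt/(_ _ eps0)][N1 _ hN1].
case: fin => N2 _ hN2.
pose N := (maxn N0 (maxn L (maxn N1 N2))).
have [LN NN1 NN2] : [/\ (L <= N)%N, (N1 <= N)%N & (N2 <= N)%N].
  by rewrite /N !leq_max !leqnn !orbT.
exists N; first exact: leq_maxl.
rewrite ge0_integral_atomic_measure//; last 2 first.
- exact: measurable_sqr_node_poly.
- by move=> t; rewrite lee_fin horner_sqr_ge0.
apply: (@le_trans _ _ (\sum_(N <= k <oo) (K * e ^+ k)%:E)%E); last first.
  have := hN1 N; have := hN2 N; rewrite /= => hb ha.
  have hb' := hb NN2; have := ha NN1.
  rewrite -[leLHS](fineK hb') lee_fin sub0r normrN => /ltW; apply: le_trans.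
  exact: ler_norm.
have t0 k : (0 <= (s k)%:E * ((node_poly dyadic S N ^+ 2).[dyadic k])%:E)%E.
  by rewrite -EFinM lee_fin mulr_ge0// horner_sqr_ge0.
rewrite (@nneseries_split _ _ 0 N)//.
rewrite add0n big_nat big1 ?add0r; last first.
  move=> k /= kN; case: (boolP (S k)) => Sk; last by rewrite sS// mul0e.
  rewrite horner_exp horner_node_poly (bigD1 (Ordinal kN))//=.
  by rewrite divff ?dyadic_neq0// subrr mul0r expr0n mule0.
rewrite [leLHS]ereal_series [leRHS]ereal_series.
apply: lee_nneseries => [k _ _|k /= Nk]; first exact: t0.
rewrite -EFinM lee_fin.
rewrite -(@ler_pM2r _ (2 ^+ (2 * M * k) * 2 ^+ (k * k + k))) ?mulr_gt0 ?exprn_gt0//.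
set V := horner _ _; pose A := 2 ^+ (2 * M * k) : R; pose B := 2 ^+ (k * k + k) : R.
have h1 : V * A <= 2 ^+ (k * k + k + 2 * L * M) by apply: node_poly_dyadic_bound.
have h2 := sC k.
rewrite -/A -/B in h2 *.
have -> : s k * V * (A * B) = (s k * B) * (V * A) by ring.
have -> : K * e ^+ k * (A * B) = (C * e ^+ k * A) * 2 ^+ (k * k + k + 2 * L * M).
  by rewrite /K /B !exprD; ring.
apply: ler_pM => //; rewrite mulr_ge0 ?horner_sqr_ge0 ?exprn_ge0//.
Qed.

End dyadic_nodes.

(** * Series with nonnegative terms *)

Section nonnegative_series.
Context {R : realType}.
Implicit Types f g : nat -> R.

(** Real-valued, so that moments can be subtracted; meaningful only for
    [nnsummable] terms. *)
Definition nnsum f : R := fine (\sum_(k <oo) (f k)%:E)%E.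

Definition nnsummable f := (forall k, 0 <= f k) /\ (\sum_(k <oo) (f k)%:E < +oo)%E.

Lemma nnsumE f : nnsummable f -> (\sum_(k <oo) (f k)%:E)%E = (nnsum f)%:E.
Proof.
move=> [f0 fy]; rewrite /nnsum fineK// ge0_fin_numE//.
by apply: nneseries_ge0 => k _ _; rewrite lee_fin.
Qed.

Lemma eq_nnsum f g : f =1 g -> nnsum f = nnsum g.
Proof. by move=> fg; congr fine; apply: eq_eseriesr => k _; rewrite fg. Qed.

Lemma nnsummableD f g : nnsummable f -> nnsummable g ->
  nnsummable (fun k => f k + g k).
Proof.
move=> [f0 fy] [g0 gy]; split=> [k|]; first by rewrite addr_ge0.
under eq_eseriesr do rewrite EFinD.
by rewrite nneseriesD ?lte_add_pinfty// => k _ _; rewrite lee_fin.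
Qed.

Lemma nnsumD f g : nnsummable f -> nnsummable g ->
  nnsum (fun k => f k + g k) = nnsum f + nnsum g.
Proof.
move=> sf sg; apply: EFin_inj; rewrite -nnsumE; last exact: nnsummableD.
under eq_eseriesr do rewrite EFinD.
case: (sf) (sg) => f0 _ [g0 _].
by rewrite nneseriesD ?nnsumE// => k _ _; rewrite lee_fin.
Qed.

Lemma nnsummableZ c f : 0 <= c -> nnsummable f -> nnsummable (fun k => c * f k).
Proof.
move=> c0 [f0 fy]; split=> [k|]; first by rewrite mulr_ge0.
under eq_eseriesr do rewrite EFinM.
rewrite nneseriesZl => [|k _]; last by rewrite lee_fin.
have : (\sum_(k <oo) (f k)%:E)%E \is a fin_num.
  rewrite ge0_fin_numE//; apply: nneseries_ge0 => k _ _; by rewrite lee_fin.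
by move=> /fineK <-; rewrite -EFinM ltry.
Qed.

Lemma nnsumZ c f : 0 <= c -> nnsummable f -> nnsum (fun k => c * f k) = c * nnsum f.
Proof.
move=> c0 sf; apply: EFin_inj; rewrite -nnsumE; last exact: nnsummableZ.
under eq_eseriesr do rewrite EFinM.
case: (sf) => f0 _.
by rewrite nneseriesZl ?nnsumE// => k _; rewrite lee_fin.
Qed.

Lemma nnsummable_le f g : (forall k, 0 <= f k <= g k) -> nnsummable g -> nnsummable f.
Proof.
move=> fg [g0 gy]; split=> [k|]; first by case/andP: (fg k).
apply: le_lt_trans gy; apply: lee_nneseries => k _.
  by rewrite lee_fin; case/andP: (fg k).
by rewrite lee_fin; case/andP: (fg k).
Qed.

Lemma nnsum_le f g : (forall k, 0 <= f k <= g k) -> nnsummable g -> nnsum f <= nnsum g.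
Proof.
move=> fg sg; rewrite -lee_fin -!nnsumE//; last exact: nnsummable_le sg.
by apply: lee_nneseries => k _; rewrite lee_fin; case/andP: (fg k).
Qed.

Lemma nnsum_ge0 f : (forall k, 0 <= f k) -> 0 <= nnsum f.
Proof.
by move=> f0; apply: fine_ge0; apply: nneseries_ge0 => k _ _; rewrite lee_fin.
Qed.

Lemma nnseries_recl f : (forall k, 0 <= f k) ->
  (\sum_(k <oo) (f k)%:E = (f 0%N)%:E + \sum_(k <oo) (f k.+1)%:E)%E.
Proof.
move=> f0; rewrite nneseries_recl//; last by move=> k _; rewrite lee_fin.
congr (_ + _)%E.
rewrite -(@nneseries_addn R (fun k => (f k)%:E) 1); last by move=> k; rewrite lee_fin.
by apply: eq_eseriesr => k _; rewrite addn1.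
Qed.

Lemma nnsummableS f : nnsummable f -> nnsummable (f \o S).
Proof.
move=> [f0 fy]; split=> [k|]; first exact: f0.
move: fy; rewrite nnseries_recl//; apply: le_lt_trans.
by rewrite leeDr// lee_fin.
Qed.

Lemma nnsum_recl f : nnsummable f -> nnsum f = f 0%N + nnsum (f \o S).
Proof.
move=> sf; apply: EFin_inj; rewrite -nnsumE// nnseries_recl; last by case: sf.
by rewrite EFinD -(nnsumE (nnsummableS sf)).
Qed.

Lemma nnsum_ge_term f j : nnsummable f -> f j <= nnsum f.
Proof.
elim: j f => [|j ih] f sf; have [f0 _] := sf; rewrite nnsum_recl//.
  by rewrite lerDl nnsum_ge0 => //= k; exact: f0.
by apply: (le_trans (ih _ (nnsummableS sf))); rewrite lerDr f0.
Qed.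

End nonnegative_series.

(** * Al-Salam-Carlitz masses and their moments *)

Section weights.
Context {R : realType}.
Implicit Types (a c rho : R).

(** Up to constant factors these are the masses, along a dyadic progression, of
    an orthogonality measure of the Al-Salam-Carlitz polynomials with
    [q = 1/2]; the values [c = 1/a] and [c = a] give the two measures below. *)
Definition carlitz c (k : nat) : R :=
  \prod_(j < k) (2 / ((2 ^+ j.+1 - 1) * (c * 2 ^+ j.+1 - 1))).

Lemma pow2_gt1 j : 1 < (2 : R) ^+ j.+1.
Proof. by rewrite exprn_egt1// ltr1n. Qed.

Lemma carlitz_den_gt0 c j : 2^-1 < c -> 0 < (2 ^+ j.+1 - 1) * (c * 2 ^+ j.+1 - 1).
Proof.
move=> c2; rewrite mulr_gt0// subr_gt0 ?pow2_gt1//.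
rewrite exprS mulrA; apply: (@lt_le_trans _ _ (c * 2)); first lra.
by rewrite ler_peMr ?exprn_ege1 ?ler1n//; lra.
Qed.

Lemma carlitz0 c : carlitz c 0 = 1.
Proof. by rewrite /carlitz big_ord0. Qed.

Lemma carlitzS c k : 2^-1 < c ->
  carlitz c k.+1 * ((2 ^+ k.+1 - 1) * (c * 2 ^+ k.+1 - 1)) = 2 * carlitz c k.
Proof.
move=> c2; rewrite /carlitz big_ord_recr/= -mulrA divfK ?(mulrC 2)//.
by rewrite gt_eqF// carlitz_den_gt0.
Qed.

Lemma carlitz_gt0 c k : 2^-1 < c -> 0 < carlitz c k.
Proof. by move=> c2; apply: prodr_gt0 => j _; rewrite divr_gt0// carlitz_den_gt0. Qed.

(** Dividing the factors by [c 4 ^ j] leaves a convergent infinite product. *)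
Lemma carlitz_bound c : 2^-1 < c ->
  exists C, forall k, carlitz c k * (c ^+ k * 2 ^+ (k * k)) <= C.
Proof.
move=> c2; have c0 : 0 < c by lra.
pose f j := (1 - (2 ^+ j.+1)^-1) * (1 - (c * 2 ^+ j.+1)^-1) : R.
have fE j : f j = ((2 ^+ j.+1 - 1) * (c * 2 ^+ j.+1 - 1)) / (c * 2 ^+ (2 * j.+1)).
  rewrite /f mul2n -addnn exprD; field.
  by rewrite (gt_eqF c0) !expf_neq0.
have f0 j : 0 < f j.
  by rewrite fE divr_gt0 ?carlitz_den_gt0// mulr_gt0// exprn_gt0.
have [] := @prod_bounded_below R f (1 + c^-1) f0.
  move=> j; rewrite /f exprS; set t := 2 ^+ j.
  have t0 : 0 < t by rewrite exprn_gt0.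
  set u := (2 * t)^-1; have u0 : 0 < u by rewrite invr_gt0 mulr_gt0.
  have -> : (c * (2 * t))^-1 = c^-1 * u by rewrite invfM.
  have -> : (1 + c^-1) / t = 2 * (u + c^-1 * u).
    by rewrite /u; field; rewrite (gt_eqF c0) (gt_eqF t0).
  have : 0 < c^-1 by rewrite invr_gt0.
  move: (c^-1) => d d0; nra.
move=> e e0 he; exists e^-1 => k.
have key : carlitz c k * (c ^+ k * 2 ^+ (k * k)) * \prod_(j < k) f j = 1.
  elim: k => [|k ih]; first by rewrite carlitz0 !big_ord0 muln0 !expr0 !mulr1.
  rewrite big_ord_recr/= -[RHS]ih.
  rewrite fE.
  have -> : (k.+1 * k.+1 = k * k + 2 * k + 1)%N by nia.
  rewrite mulnS mul2n -addnn !exprD expr1 (exprS c).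
  have h := carlitzS k c2.
  set A := _ * (_ - 1) in h *; set P := \prod_(_ < _) _.
  have -> : carlitz c k = carlitz c k.+1 * A / 2 by rewrite h mulrC mulKf.
  by field; rewrite (gt_eqF c0) expf_neq0.
rewrite -[leRHS]mul1r ler_pdivlMr// -[leRHS]key ler_wpM2l//.
by rewrite !mulr_ge0 ?exprn_ge0 ?(ltW c0) ?(ltW (carlitz_gt0 _ _)).
Qed.

Definition carlitz_sum c rho : R := nnsum (fun k => carlitz c k * rho ^+ k).

Lemma carlitz_summable c n : 2^-1 < c -> nnsummable (fun k => carlitz c k * (2 ^+ n) ^+ k).
Proof.
move=> c2; have c0 : 0 < c by lra.
split=> [k|]; first by rewrite mulr_ge0 ?exprn_ge0 ?(ltW (carlitz_gt0 _ _)).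
have [C hC] := carlitz_bound c2.
have C0 : 0 <= C by have := hC 0%N; rewrite carlitz0 muln0 !expr0 !mulr1; lra.
rewrite (eq_eseriesr (g := fun k => (carlitz c k * dyadic 1 k ^+ n)%:E)); last first.
  by move=> k _; rewrite /dyadic mul1r -!exprM mulnC.
apply: (@gauss_summable R 1 ltr01 _ C 1) => [k|k]; first by rewrite (ltW (carlitz_gt0 _ _)).
rewrite -(@ler_pM2r _ (c ^+ k)) ?exprn_gt0//.
apply: (@le_trans _ _ C); first by have := hC k; rewrite (mulrC (c ^+ k)) mulrA.
rewrite mul1n -mulrA -exprMn ler_peMr// exprn_ege1//; lra.
Qed.

Lemma carlitz_summable_le c n rho : 2^-1 < c -> 0 <= rho <= 2 ^+ n ->
  nnsummable (fun k => carlitz c k * rho ^+ k).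
Proof.
move=> c2 /andP[r0 rn]; apply: nnsummable_le (carlitz_summable n c2) => k.
rewrite mulr_ge0 ?exprn_ge0 ?(ltW (carlitz_gt0 _ _))//= ler_wpM2l ?(ltW (carlitz_gt0 _ _))//.
by rewrite lerXn2r// nnegrE exprn_ge0.
Qed.

(** Multiplying the mass at [2 ^ k] by [(2 ^ k - 1) (c 2 ^ k - 1)], which kills
    the first term, turns it into twice the previous mass; summing against
    [rho ^ k] gives a three-term recurrence for the moments. *)
Lemma carlitz_sum_rec c n rho : 2^-1 < c -> 0 < rho <= 2 ^+ n ->
  c * carlitz_sum c (4 * rho) + carlitz_sum c rho =
  (1 + c) * carlitz_sum c (2 * rho) + 2 * rho * carlitz_sum c rho.
Proof.
move=> c2 /andP[r0 rn]; have c0 : 0 < c by lra.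
have r0' := ltW r0.
have s1 : nnsummable (fun k => carlitz c k * rho ^+ k).
  by apply: (@carlitz_summable_le c n); rewrite ?r0'.
have s2 : nnsummable (fun k => carlitz c k * (2 * rho) ^+ k).
  by apply: (@carlitz_summable_le c n.+1) => //; rewrite mulr_ge0//= exprS ler_pM2l.
have s4 : nnsummable (fun k => carlitz c k * (4 * rho) ^+ k).
  apply: (@carlitz_summable_le c n.+2) => //; rewrite mulr_ge0//= !exprS mulrA.
  by rewrite -natrM ler_pM2l.
pose h k : R := if k is k'.+1 then 2 * rho * (carlitz c k' * rho ^+ k') else 0.
have sh' : nnsummable (h \o S).
  by apply: (nnsummableZ (f := fun k => carlitz c k * rho ^+ k)) => //; rewrite mulr_ge0.
have sh : nnsummable h.
  split=> [[|k]//|]; first by case: sh' => + _ => /(_ k).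
  rewrite nnseries_recl; last by case=> [|k]//; case: sh' => + _ => /(_ k).
  by rewrite add0e; case: sh'.
have -> : 2 * rho * carlitz_sum c rho = nnsum h.
  by rewrite nnsum_recl// add0r /carlitz_sum -nnsumZ// mulr_ge0.
rewrite /carlitz_sum -!nnsumZ ?addr_ge0 ?(ltW c0)// -!nnsumD//;
  try by apply: nnsummableZ; rewrite ?addr_ge0 ?(ltW c0).
apply: eq_nnsum => -[|k].
  by rewrite carlitz0 !expr0 !mulr1 /= addr0 addrC.
have -> : h k.+1 = 2 * carlitz c k * rho ^+ k.+1 by rewrite /= exprS; ring.
rewrite -carlitzS// !exprMn.
have -> : 4 ^+ k.+1 = 2 ^+ k.+1 * 2 ^+ k.+1 :> R by rewrite -exprMn -natrM.
ring.
Qed.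

(** For [rho = 1/2] the two terms of negative index cancel, so that the second
    moment is a multiple of the first and the recurrence has only one free
    constant. *)
Lemma carlitz_sum_first c : 2^-1 < c -> c * carlitz_sum c 2 = (1 + c) * carlitz_sum c 1.
Proof.
move=> c2; have := @carlitz_sum_rec c 0 2^-1 c2.
rewrite invr_gt0 ltr0n/= invf_le1// ler1n => /(_ isT).
rewrite divff// mul1r.
have -> : (4 / 2 : R) = 2 by rewrite -[4]/((2 * 2)%:R) natrM mulfK.
by move/addIr.
Qed.

End weights.

(** * Two measures with equal moments *)

Section two_measures.
Context {R : realType}.
Variable kappa : nat.

(** The ratio [a] between the two progressions [a 2 ^ k] and [2 ^ k] has to be
    close to 2: the mass of the first node [a] then exceeds [a ^ kappa] times the
    mass 1 of the point 1. *)
Definition node_scale : R := 2 - (8 * 2 ^+ kappa)^-1.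
Local Notation a := node_scale.

Lemma node_scale_bounds : 1 < a < 2.
Proof.
have h : 0 < (8 * 2 ^+ kappa : R)^-1 by rewrite invr_gt0 mulr_gt0// exprn_gt0.
have : (8 * 2 ^+ kappa : R)^-1 <= 8^-1.
  by rewrite lef_pV2 ?posrE ?mulr_gt0 ?exprn_gt0// ler_peMr// exprn_ege1// ler1n.
rewrite /a; lra.
Qed.

Let a1 : 1 < a. Proof. by case/andP: node_scale_bounds. Qed.
Let a2 : a < 2. Proof. by case/andP: node_scale_bounds. Qed.
Let a0 : 0 < a. Proof. exact: lt_trans a1. Qed.
Let ca : 2^-1 < a. Proof. by move: a1; lra. Qed.
Let cb : 2^-1 < a^-1. Proof. by rewrite ltf_pV2 ?posrE. Qed.

Definition pow2_mass (k : nat) : R := carlitz a^-1 k.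
Definition mass_ratio : R := carlitz_sum a^-1 1 / carlitz_sum a 1.
(** Locked, so that unification does not see the product. *)
Definition lam_mass : nat -> R := locked (fun k => mass_ratio * carlitz a k).

Lemma lam_massE k : lam_mass k = mass_ratio * carlitz a k.
Proof. by rewrite /lam_mass -lock. Qed.

Local Notation lam := (dyadic a).
Local Notation pow2 := (dyadic (1 : R)).

Lemma pow2_mass_gt0 k : 0 < pow2_mass k.
Proof. exact: carlitz_gt0. Qed.

Lemma carlitz_sum_gt0 (c : R) : 2^-1 < c -> 0 < carlitz_sum c 1.
Proof.
move=> c2; apply: lt_le_trans (nnsum_ge_term 0 _).
  by rewrite carlitz0 expr0 mulr1.
by apply: (@carlitz_summable_le R c 0) => //; rewrite ler01 expr0/=.
Qed.

Lemma mass_ratio_gt0 : 0 < mass_ratio.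
Proof. by rewrite divr_gt0// carlitz_sum_gt0. Qed.

Lemma lam_mass_gt0 k : 0 < lam_mass k.
Proof. by rewrite lam_massE mulr_gt0// ?mass_ratio_gt0// carlitz_gt0. Qed.

Lemma pow2_mass0 : pow2_mass 0 = 1.
Proof. exact: carlitz0. Qed.

(** One step of the recursion for the masses costs less than a factor
    [(2 ^ k) ^ 2].  This is why multiplying by the square of the variable
    dominates a shift of the lattice by one step. *)
Lemma pow2_mass_le k : pow2_mass k <= pow2_mass k.+1 * pow2 k.+1 ^+ 2.
Proof.
have := carlitzS k cb; rewrite -/(pow2_mass _) -/(pow2_mass _) /dyadic mul1r => h.
have p0 := pow2_mass_gt0 k.+1; have t1 := @pow2_gt1 R k.
have b1 : a^-1 < 1 by rewrite invf_lt1.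
have b0 : 2^-1 < a^-1 := cb.
set t := 2 ^+ k.+1 in h t1 *.
suff : (t - 1) * (a^-1 * t - 1) <= 2 * t ^+ 2 by move=> h'; nra.
move: (a^-1) b0 b1 => d; nra.
Qed.

Lemma pow2_mass_bound : exists C, forall k, pow2_mass k * 2 ^+ (k * k) <= C * a ^+ k.
Proof.
have [C hC] := carlitz_bound cb; exists C => k.
rewrite -ler_pdivrMr ?exprn_gt0// -exprVn -mulrA (mulrC (2 ^+ _)); exact: hC.
Qed.

Lemma lam_mass_bound : exists C, forall k, lam_mass k * 2 ^+ (k * k) <= C * (a^-1) ^+ k.
Proof.
have [C hC] := carlitz_bound ca; exists (mass_ratio * C) => k.
rewrite exprVn ler_pdivlMr ?exprn_gt0// lam_massE.
move: mass_ratio (ltW mass_ratio_gt0) => r r0.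
have -> : r * carlitz a k * 2 ^+ (k * k) * a ^+ k = r * (carlitz a k * (a ^+ k * 2 ^+ (k * k))).
  by ring.
by rewrite ler_wpM2l.
Qed.

Lemma pow2_mass_summable n : nnsummable (fun k => pow2_mass k * pow2 k ^+ n).
Proof.
have := carlitz_summable n cb; rewrite (_ : (fun k => _) = (fun k => pow2_mass k * pow2 k ^+ n))//.
by apply/funext => k; rewrite /dyadic mul1r -!exprM mulnC.
Qed.

Lemma pow2_massE n : nnsum (fun k => pow2_mass k * pow2 k ^+ n) = carlitz_sum a^-1 (2 ^+ n).
Proof. by apply: eq_nnsum => k; rewrite /dyadic mul1r -!exprM mulnC. Qed.

Lemma lam_mass_term n k : lam_mass k * lam k ^+ n =
  (mass_ratio * a ^+ n) * (carlitz a k * (2 ^+ n) ^+ k).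
Proof. by rewrite lam_massE /dyadic exprMn -!exprM (mulnC k); ring. Qed.

Lemma lam_mass_summable n : nnsummable (fun k => lam_mass k * lam k ^+ n).
Proof.
rewrite (_ : (fun k => _) = (fun k => (mass_ratio * a ^+ n) * (carlitz a k * (2 ^+ n) ^+ k))).
  apply: nnsummableZ; last exact: carlitz_summable.
  by rewrite mulr_ge0 ?exprn_ge0 ?(ltW a0) ?(ltW mass_ratio_gt0).
by apply/funext => k; exact: lam_mass_term.
Qed.

Lemma lam_mass_sum n : nnsum (fun k => lam_mass k * lam k ^+ n) =
  mass_ratio * (a ^+ n * carlitz_sum a (2 ^+ n)).
Proof.
rewrite (eq_nnsum (lam_mass_term n)) nnsumZ ?mulrA//; last exact: carlitz_summable.
by rewrite mulr_ge0 ?exprn_ge0 ?(ltW a0) ?(ltW mass_ratio_gt0).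
Qed.

(** Written in the nodes [x = 2 ^ k] and [x = a 2 ^ k] respectively, both mass
    recursions have the same factor [(x - 1) (x / a - 1)].  The two moment
    sequences therefore satisfy the same recurrence, and they agree at the
    start by the choice of [mass_ratio]. *)
Lemma eq_moments n : nnsum (fun k => pow2_mass k * pow2 k ^+ n) =
  nnsum (fun k => lam_mass k * lam k ^+ n).
Proof.
rewrite pow2_massE lam_mass_sum.
suff : carlitz_sum a^-1 (2 ^+ n) = mass_ratio * (a ^+ n * carlitz_sum a (2 ^+ n)) /\
  carlitz_sum a^-1 (2 ^+ n.+1) = mass_ratio * (a ^+ n.+1 * carlitz_sum a (2 ^+ n.+1)) by case.
have ane : a != 0 by rewrite gt_eqF.
elim: n => [|n [ih1 ih2]].
  have e0 : carlitz_sum a^-1 1 = mass_ratio * carlitz_sum a 1.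
    by rewrite /mass_ratio divfK// gt_eqF// carlitz_sum_gt0.
  rewrite !expr0 !expr1 mul1r; split => //.
  have h1 := carlitz_sum_first ca; have h2 := carlitz_sum_first cb.
  rewrite mulrA -mulrA h1.
  have -> : carlitz_sum a^-1 2 = (a + 1) * carlitz_sum a^-1 1.
    by rewrite -[LHS](@mulKf _ a^-1) ?invr_eq0// h2 invrK mulrA mulrDr mulfV ?mulr1.
  by rewrite e0; ring.
split=> //.
have r n0 : 0 < (2 : R) ^+ n0 <= 2 ^+ n0 by rewrite exprn_gt0 ?lexx.
have h1 := carlitz_sum_rec ca (r n); have h2 := carlitz_sum_rec cb (r n).
have e1 : (2 : R) ^+ n.+1 = 2 * 2 ^+ n by rewrite exprS.
have e2 : (2 : R) ^+ n.+2 = 4 * 2 ^+ n by rewrite !exprS mulrA -natrM.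
rewrite !e1 !e2 in ih1 ih2 *.
set W2 := carlitz_sum _ (4 * _) in h2 *; set V2 := carlitz_sum a (4 * _) in h1 *.
have -> : W2 = a * ((1 + a^-1) * carlitz_sum a^-1 (2 * 2 ^+ n) + (2 * 2 ^+ n - 1) * carlitz_sum a^-1 (2 ^+ n)).
  apply: (@mulfI _ a^-1); rewrite ?invr_eq0// mulKf// mulrBl mul1r addrA -h2; ring.
rewrite ih1 ih2.
have -> : a ^+ n.+2 * V2 = a ^+ n.+1 * (a * V2) by rewrite exprS; ring.
have -> : a * V2 = (1 + a) * carlitz_sum a (2 * 2 ^+ n) + (2 * 2 ^+ n - 1) * carlitz_sum a (2 ^+ n).
  by move: h1; lra.
by rewrite exprS; field.
Qed.

(** The first term alone exceeds 1, because [mass_ratio > 2 ^ kappa]: the total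
    mass of [pow2_mass] is at least the mass of the point 2, which is at least
    [16 2 ^ kappa], while the unnormalised masses at the nodes [lam k] add up to
    at most 8. *)
Lemma lam_mass_neg_moment : 1 < nnsum (fun k => lam_mass k / lam k ^+ kappa).
Proof.
have vs : nnsummable (fun k => lam_mass k / lam k ^+ kappa).
  apply: (nnsummable_le _ (lam_mass_summable 0)) => k.
  have l1 : 1 <= lam k by rewrite /dyadic mulr_ege1 ?(ltW a1)// exprn_ege1// ler1n.
  rewrite expr0 mulr1 divr_ge0 ?(ltW (lam_mass_gt0 k)) ?exprn_ge0 ?(ltW (dyadic_gt0 a0 k))//=.
  by rewrite ler_pdivrMr ?exprn_gt0 ?dyadic_gt0// ler_peMr ?(ltW (lam_mass_gt0 k))// exprn_ege1.
apply: lt_le_trans (nnsum_ge_term 0 vs).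
rewrite lam_massE carlitz0 mulr1 /dyadic expr0 mulr1.
rewrite ltr_pdivlMr ?exprn_gt0// mul1r.
have ak : a ^+ kappa <= 2 ^+ kappa by rewrite lerXn2r ?nnegrE ?(ltW a0)// ltW.
apply: (le_lt_trans ak).
rewrite /mass_ratio ltr_pdivlMr ?carlitz_sum_gt0//.
have V8 : carlitz_sum a 1 <= 8.
  have s1 : nnsummable (fun k => carlitz a k * 1 ^+ k).
    by apply: (@carlitz_summable_le R a 0) => //; rewrite ler01 expr0/=.
  have -> : 8 = 4 / (1 - 2^-1) :> R by field.
  rewrite -lee_fin /carlitz_sum -nnsumE//; apply: geometric_le.
    by rewrite invr_ge0 ler0n/= invf_lt1// ltr1n.
  move=> k; rewrite expr1n mulr1 (ltW (carlitz_gt0 k ca))/=.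
  elim: k => [|k ih]; first by rewrite carlitz0 expr0 mulr1 ler1n.
  have := carlitzS k ca; have := carlitz_gt0 k.+1 ca; have := carlitz_gt0 k ca.
  case: k => [|k] in ih *.
    rewrite carlitz0 !expr1; move: a1; set b := node_scale; nra.
  move: ih; rewrite !exprSr; set t := 2 ^+ k; set u := (2^-1) ^+ k.
  have t1 : 1 <= t by rewrite exprn_ege1// ler1n.
  move: (carlitz _ _) (carlitz _ _) => x y ih x0 y0 h.
  have : 4 <= (t * 2 * 2 - 1) * (a * (t * 2 * 2) - 1).
    have h1 : 3 <= t * 2 * 2 - 1 by lra.
    have h2 : t * 2 * 2 <= a * (t * 2 * 2) by rewrite ler_peMl ?(ltW a1)//; lra.
    have h3 : 3 <= a * (t * 2 * 2) - 1 by lra.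
    apply: (@le_trans _ _ (3 * 3)); first lra.
    by apply: ler_pM.
  move: (_ * (_ - 1)) h => d h d4.
  nra.
have W16 : 16 * 2 ^+ kappa <= carlitz_sum a^-1 1.
  have s1 : nnsummable (fun k => carlitz a^-1 k * 1 ^+ k).
    by apply: (@carlitz_summable_le R a^-1 0) => //; rewrite ler01 expr0/=.
  apply: (le_trans _ (nnsum_ge_term 1 s1)).
  have h := carlitzS 0 cb; rewrite carlitz0 !expr1 mulr1 in h.
  rewrite expr1 mulr1.
  have p0 : (8 * 2 ^+ kappa : R) != 0 by rewrite mulf_neq0// expf_neq0.
  have ane : a != 0 by rewrite gt_eqF.
  have e : (2 - 1) * (a^-1 * 2 - 1) = a^-1 * (8 * 2 ^+ kappa)^-1.
    have -> : (8 * 2 ^+ kappa : R)^-1 = 2 - a by rewrite /node_scale; ring.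
    by field.
  rewrite e in h.
  have -> : carlitz a^-1 1 = 2 * (a * (8 * 2 ^+ kappa)).
    rewrite -[LHS](@mulfK _ (a^-1 * (8 * 2 ^+ kappa)^-1)).
      by rewrite h invfM !invrK.
    by rewrite mulf_neq0 ?invr_eq0.
  have t0 : 0 < (2 : R) ^+ kappa by rewrite exprn_gt0.
  have : 2 ^+ kappa <= a * 2 ^+ kappa by rewrite ler_peMl ?(ltW a1)// ltW.
  by lra.
have t0 : 0 < (2 : R) ^+ kappa by rewrite exprn_gt0.
have : 2 ^+ kappa * carlitz_sum a 1 <= 2 ^+ kappa * 8 by rewrite ler_pM2l.
lra.
Qed.

End two_measures.

(** * Index of determinacy of discrete measures *)

Section index.
Context {R : realType}.
Local Notation borelR := (measurableTypeR R).
Implicit Types (nu : {measure set borelR -> \bar R}).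

Lemma measure_eq_moment nu nu' : measure_eq nu nu' -> moment nu = moment nu'.
Proof.
by move=> e; apply/funext => n; apply: eq_measure_integral => A mA _; exact: e.
Qed.

Lemma H_determinate_unique (g : nat -> \bar R) (nu nu' : {measure set borelR -> \bar R}) :
  H_determinate g -> H_representing g nu -> H_representing g nu' -> measure_eq nu nu'.
Proof. by move=> [m [_ h]] hn hn' A mA; rewrite -(h _ hn A mA) (h _ hn' A mA). Qed.

Lemma measure_eq_H_determinate nu nu' : measure_eq nu nu' ->
  H_determinate_measure nu -> H_determinate_measure nu'.
Proof.
move=> e [h d]; split; last by rewrite -(measure_eq_moment e).
move=> n; have := h n; rewrite (@eq_measure_integral _ _ _ _ nu')// => A mA _.
exact: e.
Qed.

Lemma S_representing_eq g nu nu' : measure_eq nu nu' ->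
  S_representing g nu -> S_representing g nu'.
Proof.
move=> e [fm /supported_on_RplusP n0 gE].
have eI f : (\int[nu']_t f t = \int[nu]_t f t)%E.
  by apply: eq_measure_integral => A mA _; rewrite e.
split=> [n||n].
- by rewrite eI; exact: fm.
- by apply/supported_on_RplusP; rewrite -e//; exact: measurable_itv.
- by rewrite gE -(measure_eq_moment e).
Qed.

(** The weight at 0 is [`|t| ^ (2 k)], which is [t ^ (2 k)] also for negative
    [t]. *)
Lemma weighted_atomic_measure (s x : nat -> R) k : (forall j, 0 <= s j) ->
  measure_eq (weighted (@atomic_measure R _ borelR s x) 0 k)
             (@atomic_measure R _ borelR (fun j => s j * x j ^+ (2 * k)) x).
Proof.
move=> s0 A mA.
transitivity (\int[@atomic_measure R _ borelR s x]_(t in A) (weight 0 k t)%:E)%E; first by [].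
have x0 j : 0 <= x j ^+ (2 * k) by rewrite exprM exprn_ge0// sqr_ge0.
have wE (t : R) : weight 0 k t = t ^+ (2 * k).
  rewrite /weight subr0 /real_complex_def/= expr0n/= addr0 sqrtr_sqr.
  by rewrite !exprM real_normK// num_real.
rewrite atomic_measureE; last by move=> j; rewrite mulr_ge0.
rewrite integral_mkcond ge0_integral_atomic_measure//.
- apply: eq_eseriesr => j _.
  rewrite patchE indicE; case: ifP => _; last by rewrite mule0 mulr0.
  by rewrite mulr1 wE.
- apply/(measurable_restrictT _ mA); apply: measurable_funTS.
  by apply/measurable_EFinP; exact: measurable_weight.
- by move=> t; rewrite patchE; case: ifP => // _; rewrite lee_fin weight_ge0.
Qed.

Lemma index_at_infinite (s x : nat -> R) : (forall j, 0 <= s j) ->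
  (forall k, H_determinate_measure
     (@atomic_measure R _ borelR (fun j => s j * x j ^+ (2 * k)) x)) ->
  index_at 0 (@atomic_measure R _ borelR s x) = +oo%E.
Proof.
move=> s0 h; apply/eqyP => A A0; pose k := (Num.truncn A).+1.
apply: (@le_trans _ _ (k%:R)%:E); first by rewrite lee_fin ltW// truncnS_gt.
apply: ereal_sup_ubound; exists k => //=.
apply: measure_eq_H_determinate (h k) => B mB.
by rewrite weighted_atomic_measure.
Qed.

Lemma index_at_zero (s x : nat -> R) : (forall j, 0 <= s j) ->
  H_determinate_measure (@atomic_measure R _ borelR s x) ->
  (forall k, (0 < k)%N -> ~ H_determinate_measure
     (@atomic_measure R _ borelR (fun j => s j * x j ^+ (2 * k)) x)) ->
  index_at 0 (@atomic_measure R _ borelR s x) = 0%E.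
Proof.
move=> s0 h0 h; rewrite /index_at; apply/eqP; rewrite eq_le; apply/andP; split.
  apply: ge_ereal_sup => _ [[|k] hk <-]//.
  exfalso; apply: (h k.+1) => //.
  exact: (measure_eq_H_determinate (weighted_atomic_measure x k.+1 s0)).
apply: ereal_sup_ubound; exists 0%N => //=.
apply: (@measure_eq_H_determinate (@atomic_measure R _ borelR s x)) => //.
move=> A mA; rewrite weighted_atomic_measure// !atomic_measureE//.
  by apply: eq_eseriesr => j _; rewrite muln0 expr0 mulr1.
by move=> j; rewrite muln0 expr0 mulr1.
Qed.

End index.

(** * Determinacy of the measures at the circuit and on the branches *)

Section extremal_measures.
Context {R : realType}.
Local Notation borelR := (measurableTypeR R).
Variable kappa : nat.
Local Notation a := (@node_scale R kappa).
Local Notation lam := (dyadic a).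
Local Notation pow2 := (dyadic (1 : R)).
Local Notation w := (@pow2_mass R kappa).
Local Notation v := (@lam_mass R kappa).

Let a1 : 1 < a. Proof. by case/andP: (@node_scale_bounds R kappa). Qed.
Let a2 : a < 2. Proof. by case/andP: (@node_scale_bounds R kappa). Qed.
Let a0 : 0 < a. Proof. exact: lt_trans a1. Qed.

(** The masses of the measure [tau] called [tau] above. *)
Definition tail_mass (k : nat) : R := if k is 0 then 0 else w k.

Lemma tail_mass_ge0 k : 0 <= tail_mass k.
Proof. by case: k => //= k; rewrite ltW ?pow2_mass_gt0. Qed.

Lemma tail_mass_le k : tail_mass k <= w k.
Proof. by case: k => //=; rewrite pow2_mass0. Qed.

(** Only one node is missing, and the gain is [4 ^ k] against masses of order
    [a ^ k 2 ^ (- k ^ 2)]: this suffices because [a < 2]. *)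
Lemma tail_mass_determinate c : 0 <= c ->
  H_determinate_measure (@atomic_measure R _ borelR (fun k => c * tail_mass k) pow2).
Proof.
move=> c0; have [C hC] := @pow2_mass_bound R kappa.
apply: (@H_determinate_dyadic R 1 ltr01 _ (fun k => k != 0) (c * C) (a / 2) 1 1).
- by move=> k; rewrite mulr_ge0// tail_mass_ge0.
- by move=> [|k]//= _; rewrite mulr0.
- by rewrite divr_ge0 ?(ltW a0)//= ltr_pdivrMr// mul1r.
- move=> k; rewrite muln1 -!mulrA ler_wpM2l// exprD mulrA.
  apply: (@le_trans _ _ ((w k * 2 ^+ (k * k)) * 2 ^+ k)).
    by rewrite ler_wpM2r ?exprn_ge0// ler_wpM2r ?exprn_ge0// tail_mass_le.
  apply: (le_trans (ler_wpM2r _ (hC k))); first by rewrite exprn_ge0.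
  rewrite le_eqVlt; apply/orP; left; apply/eqP.
  by rewrite expr_div_n mul2n -addnn exprD; field; rewrite expf_neq0.
- by rewrite big_ord1.
Qed.

(** The part of [(t - t ^ (- kappa)) d nu] on a class [S] of nodes, where [nu]
    has the masses [lam_mass]. *)
Definition branch_mass (S : pred nat) (k : nat) : R :=
  if S k then v k * (lam k - (lam k ^+ kappa)^-1) else 0.

Lemma lam_gt1 k : 1 < lam k.
Proof.
rewrite /dyadic; apply: (lt_le_trans a1).
by rewrite ler_peMr ?(ltW a0)// exprn_ege1// ler1n.
Qed.

Lemma lam_gap_gt0 k : 0 < lam k - (lam k ^+ kappa)^-1.
Proof.
rewrite subr_gt0; apply: (le_lt_trans _ (lam_gt1 k)).
by rewrite invf_le1 ?exprn_gt0 ?exprn_ege1 ?(ltW (lam_gt1 k))// (lt_trans ltr01 (lam_gt1 k)).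
Qed.

Lemma branch_mass_ge0 S k : 0 <= branch_mass S k.
Proof.
rewrite /branch_mass; case: ifP => // _.
by rewrite mulr_ge0 ?(ltW (lam_mass_gt0 _ _)) ?(ltW (lam_gap_gt0 _)).
Qed.

Lemma branch_mass_le S k : branch_mass S k <= v k * lam k.
Proof.
have v0 := ltW (@lam_mass_gt0 R kappa k); have l1 := lam_gt1 k.
rewrite /branch_mass; case: ifP => _; last by rewrite mulr_ge0// ltW// (lt_trans ltr01).
by rewrite ler_wpM2l// gerBl invr_ge0 exprn_ge0// ltW// (lt_trans ltr01).
Qed.

Lemma gaps_count (S : pred nat) M : (forall k, ~~ S k || ~~ S k.+1) ->
  (M <= \sum_(i < 2 * M) ~~ S i)%N.
Proof.
move=> hS; elim: M => [|M ih]//.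
rewrite mulnS addnC; rewrite big_split_ord/= -addn1; apply: leq_add => //.
rewrite !big_ord_recl big_ord0/=; have := hS (2 * M)%N.
by rewrite !addn0 /bump/= addn1; do 2 case: (S _).
Qed.

(** Arbitrarily many nodes are missing, enough to absorb any power of [t]. *)
Lemma branch_mass_determinate (S : pred nat) c p : 0 <= c ->
  (forall k, ~~ S k || ~~ S k.+1) ->
  H_determinate_measure (@atomic_measure R _ borelR
    (fun k => c * branch_mass S k * lam k ^+ p) lam).
Proof.
move=> c0 hS; have [C hC] := @lam_mass_bound R kappa.
have l0 k : 0 <= lam k by rewrite ltW// (lt_trans ltr01) ?lam_gt1.
apply: (@H_determinate_dyadic R a a0 _ S (c * C * a ^+ p.+1) a^-1 p.+2 (2 * p.+2)).
- by move=> k; rewrite !mulr_ge0 ?branch_mass_ge0 ?exprn_ge0.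
- by move=> k /negbTE h; rewrite /branch_mass h mulr0 mul0r.
- by rewrite invr_ge0 (ltW a0)//= invf_lt1.
- move=> k.
  apply: (@le_trans _ _ (c * (v k * lam k) * lam k ^+ p * 2 ^+ (k * k + k))).
    rewrite ler_wpM2r ?exprn_ge0// ler_wpM2r ?exprn_ge0// ler_wpM2l//.
    exact: branch_mass_le.
  have -> : c * (v k * lam k) * lam k ^+ p * 2 ^+ (k * k + k) =
     (v k * 2 ^+ (k * k)) * (c * a ^+ p.+1 * (2 ^+ (k * p.+1) * 2 ^+ k)).
    by rewrite /dyadic exprMn -exprM mulnS !exprD (exprS a); ring.
  apply: (le_trans (ler_wpM2r _ (hC k))).
    by rewrite !mulr_ge0 ?exprn_ge0// ltW.
  rewrite -exprD.
  have -> : C * a^-1 ^+ k * (c * a ^+ p.+1 * 2 ^+ (k * p.+1 + k)) =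
    c * C * a ^+ p.+1 * a^-1 ^+ k * 2 ^+ (k * p.+1 + k) by ring.
  have C0 : 0 <= C.
    have := hC 0%N; rewrite muln0 !expr0 !mulr1; apply: le_trans.
    exact: ltW (lam_mass_gt0 _ _).
  rewrite ler_wpM2l ?mulr_ge0 ?exprn_ge0 ?invr_ge0 ?(ltW a0)//.
  rewrite ler_weXn2l ?ler1n//; nia.
- exact: gaps_count.
Qed.

End extremal_measures.

(** * Indeterminacy after multiplication by a power *)

Section nonuniqueness.
Context {R : realType}.
Local Notation borelR := (measurableTypeR R).
Variable kappa : nat.
Local Notation a := (@node_scale R kappa).
Local Notation lam := (dyadic a).
Local Notation pow2 := (dyadic (1 : R)).
Local Notation w := (@pow2_mass R kappa).
Local Notation v := (@lam_mass R kappa).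

Lemma pow2_ge1 k : 1 <= pow2 k.
Proof. by rewrite /dyadic mul1r exprn_ege1// ler1n. Qed.

(** The masses at [2 ^ k] of the image of [pow2_mass] under doubling. *)
Definition shifted_mass (k : nat) : R := if k is k'.+1 then w k' else 0.

Lemma shifted_mass_le k j : (0 < j)%N ->
  shifted_mass k <= tail_mass kappa k * pow2 k ^+ (2 * j).
Proof.
case: k => [|k] j0 /=; first by rewrite mul0r.
apply: (le_trans (pow2_mass_le kappa k)); rewrite ler_wpM2l ?(ltW (pow2_mass_gt0 _ _))//.
by rewrite ler_weXn2l ?pow2_ge1//; lia.
Qed.

Lemma tail_mass_summable c m n : 0 <= c ->
  nnsummable (fun k => c * tail_mass kappa k * pow2 k ^+ m * pow2 k ^+ n).
Proof.
move=> c0; apply: nnsummable_le (nnsummableZ c0 (pow2_mass_summable kappa (m + n))) => k.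
have p0 : 0 <= pow2 k by rewrite (le_trans ler01) ?pow2_ge1.
rewrite !mulr_ge0 ?tail_mass_ge0 ?exprn_ge0//= -!mulrA -exprD ler_wpM2l//.
by rewrite ler_wpM2r ?exprn_ge0// tail_mass_le.
Qed.

(** After multiplication by [t ^ (2 j)] the measure dominates the image under
    doubling of the one with masses [pow2_mass].  Replacing this part by the
    image of the one with masses [lam_mass] keeps the moments and creates an
    atom at [2 a]. *)
Lemma tail_mass_indeterminate c j : 0 < c -> (0 < j)%N ->
  ~ H_determinate_measure (@atomic_measure R _ borelR
      (fun k => c * tail_mass kappa k * pow2 k ^+ (2 * j)) pow2).
Proof.
move=> c0 j0; set s := fun k : nat => _; move=> [fm det].
have p0 k : 0 <= pow2 k by rewrite (le_trans ler01) ?pow2_ge1.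
have a1 : 1 < a by case/andP: (@node_scale_bounds R kappa).
have a2 : a < 2 by case/andP: (@node_scale_bounds R kappa).
have a0 : 0 < a by apply: lt_trans a1.
have s0 k : 0 <= s k by rewrite !mulr_ge0 ?(ltW c0) ?tail_mass_ge0 ?exprn_ge0.
(* [s1] is what is left on the powers of 2, [s2] the new part on [2 lam] *)
pose s1 k := s k - c * shifted_mass k.
have s10 k : 0 <= s1 k.
  by rewrite subr_ge0 /s -mulrA ler_pM2l// shifted_mass_le.
have sh0 k : 0 <= shifted_mass k by case: k => //= k; rewrite ltW ?pow2_mass_gt0.
pose x2 k := 2 * lam k.
have x20 k : 0 <= x2 k by rewrite mulr_ge0// ltW// dyadic_gt0.
pose s2 k := c * v k.
have s20 k : 0 <= s2 k by rewrite mulr_ge0 ?(ltW c0)// ltW ?lam_mass_gt0.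
pose m1 := @atomic_measure R _ borelR s1 pow2; pose m2 := @atomic_measure R _ borelR s2 x2.
have ss n : nnsummable (fun k => s k * pow2 k ^+ n) by apply: tail_mass_summable; rewrite ltW.
have ss1 n : nnsummable (fun k => s1 k * pow2 k ^+ n).
  apply: nnsummable_le (ss n) => k.
  by rewrite mulr_ge0 ?exprn_ge0//= ler_wpM2r ?exprn_ge0// gerBl mulr_ge0// ltW.
have ssh n : nnsummable (fun k => c * shifted_mass k * pow2 k ^+ n).
  apply: nnsummable_le (ss n) => k.
  rewrite !mulr_ge0 ?exprn_ge0 ?(ltW c0)//= ler_wpM2r ?exprn_ge0//.
  by rewrite /s -mulrA ler_pM2l// shifted_mass_le.
have s2E n k : s2 k * x2 k ^+ n = (c * 2 ^+ n) * (v k * lam k ^+ n).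
  by rewrite /s2 /x2 exprMn; ring.
have cn n : 0 <= c * 2 ^+ n by rewrite mulr_ge0 ?exprn_ge0// ltW.
have ss2 n : nnsummable (fun k => s2 k * x2 k ^+ n).
  rewrite (_ : (fun k => _) = (fun k => (c * 2 ^+ n) * (v k * lam k ^+ n))).
    by apply: nnsummableZ => //; exact: lam_mass_summable.
  by apply/funext => k; exact: s2E.
have shE n : nnsum (fun k => c * shifted_mass k * pow2 k ^+ n) =
    nnsum (fun k => s2 k * x2 k ^+ n).
  rewrite nnsum_recl//= mulr0 mul0r add0r (eq_nnsum (s2E n)) nnsumZ//; last exact: lam_mass_summable.
  rewrite -eq_moments -nnsumZ//; last exact: pow2_mass_summable.
  by apply: eq_nnsum => k /=; rewrite /dyadic !mul1r exprS exprMn; ring.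
have mE n : (moment m1 n + moment m2 n = moment (@atomic_measure R _ borelR s pow2) n)%E.
  rewrite !moment_atomic_measure// !nnsumE// -EFinD -shE -nnsumD//.
  by congr EFin; apply: eq_nnsum => k; rewrite /s1; ring.
have n1 : m1 [set` `]-oo, (0:R)[] = 0%E by exact: atomic_measure_Rplus.
have n2 : m2 [set` `]-oo, (0:R)[] = 0%E by exact: atomic_measure_Rplus.
have rep : H_representing (moment (@atomic_measure R _ borelR s pow2)) (measure_add m1 m2).
  split=> n; last by rewrite moment_measure_add.
  have n12 : measure_add m1 m2 [set` `]-oo, (0:R)[] = 0%E.
    by rewrite measure_addE n1 n2 adde0.
  rewrite -moment_norm//.
  rewrite moment_measure_add// mE moment_atomic_measure//; exact: (ss n).2.
have := H_determinate_unique det (conj fm (fun=> erefl)) rep.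
move=> /(_ [set 2 * a] (measurable_set1 _)).
rewrite [X in _ = X](_ : _ = m1 [set (2 * a)%R] + m2 [set (2 * a)%R])%E; last exact: measure_addE.
rewrite atomic_measure_null//; last first.
  move=> k /= h; exfalso.
  have : ((2:R) ^+ 1 < (2:R) ^+ k) && ((2:R) ^+ k < (2:R) ^+ 2).
    by move: h; rewrite /dyadic mul1r => ->; rewrite expr1 expr2; move: a1 a2; lra.
  by rewrite !ltr_eXn2l ?ltr1n//; lia.
move/esym/eqP; rewrite padde_eq0// => /andP[_].
rewrite atomic_measureE//; apply/negP; rewrite gt_eqF//.
rewrite nnseries_recl; last by move=> k; rewrite mulr_ge0.
apply: (@lt_le_trans _ _ (s2 0%N * \1_([set 2 * a]) (x2 0%N))%:E).
  rewrite lte_fin; apply: mulr_gt0; first by rewrite mulr_gt0 ?lam_mass_gt0.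
  by rewrite indicE mem_set ?ltr01// /x2 /dyadic expr0 mulr1.
rewrite leeDl//; apply: nneseries_ge0 => k _ _; by rewrite lee_fin mulr_ge0.
Qed.

Lemma tail_mass_index c : 0 < c ->
  index_at 0 (@atomic_measure R _ borelR (fun k => c * tail_mass kappa k) pow2) = 0%E.
Proof.
move=> c0; apply: index_at_zero.
- by move=> k; rewrite mulr_ge0 ?tail_mass_ge0 ?(ltW c0).
- by apply: tail_mass_determinate; exact: ltW.
- by move=> k; exact: tail_mass_indeterminate.
Qed.

Lemma tail_mass_moment c n : 0 <= c ->
  moment (@atomic_measure R _ borelR (fun k => c * tail_mass kappa k) pow2) n =
  (c * (nnsum (fun k => v k * lam k ^+ n) - 1))%:E.
Proof.
move=> c0.
have sE := tail_mass_summable 0 n c0.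
rewrite moment_atomic_measure; last 2 first.
- by move=> k; rewrite mulr_ge0 ?tail_mass_ge0.
- by move=> k; rewrite (le_trans ler01) ?pow2_ge1.
rewrite (eq_eseriesr (g := fun k => (c * tail_mass kappa k * pow2 k ^+ 0 * pow2 k ^+ n)%:E)); last first.
  by move=> k _; rewrite expr0 mulr1.
rewrite nnsumE//; congr EFin.
rewrite -eq_moments [X in _ = c * (X - 1)]nnsum_recl; last exact: pow2_mass_summable.
rewrite pow2_mass0 /dyadic expr0 mulr1 expr1n mulr1 [1 + _]addrC addrK.
rewrite nnsum_recl//= !mulr0 !mul0r add0r -nnsumZ//; last first.
  exact: (nnsummableS (pow2_mass_summable kappa n)).
by apply: eq_nnsum => k /=; rewrite /dyadic; ring.
Qed.

End nonuniqueness.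

(** * Measures on the vertices of the graph *)

Section vertex_measures.
Context {R : realType} {kappa : nat} {eta : option nat}.
Local Notation X := (vertex kappa eta).
Implicit Types (m : {measure set X -> \bar R}).

Lemma ge0_integral_vertex m (f : X -> \bar R) : (forall x, (0 <= f x)%E) ->
  (\int[m]_x f x = \esum_(x in [set: X]) (f x * m [set x]))%E.
Proof.
move=> f0.
pose F k := [set x : X | pickle x = k].
have FT : [set: X] = \bigcup_k F k.
  by apply/seteqP; split => // x _; exists (pickle x).
have tF : trivIset setT F by move=> i j _ _ [x [/= <- <-]].
rewrite [in LHS]FT ge0_integral_bigcup//.
rewrite FT esum_bigcupT//; last by move=> x; rewrite mule_ge0.
rewrite nneseries_esumT; last by move=> k; apply: integral_ge0.
apply: eq_esum => k _.
have [[x xk]|nF] := pselect (exists x, F k x).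
  have -> : F k = [set x].
    apply/seteqP; split => [y|y /= ->//]; rewrite /F/= -xk.
    exact: (pcan_inj pickleK).
  rewrite esum_set1 ?mule_ge0//.
  rewrite (eq_integral (cst (f x))); last by move=> y; rewrite inE => ->.
  by rewrite integral_cst.
have -> : F k = set0 by apply/seteqP; split => // x Fx; apply: nF; exists x.
by rewrite integral_set0 esum_set0.
Qed.

Lemma measure_vertex m (A : set X) : m A = \esum_(x in A) m [set x].
Proof.
rewrite -[in LHS](setIT A) -(integral_indic m measurableT)// ge0_integral_vertex//.
rewrite [RHS]esum_mkcond; apply: eq_esum => x _.
by rewrite indicE; case: (x \in A); rewrite ?mul1e ?mul0e.
Qed.

(** [pickle_inv] rather than [unpickle] enumerates each vertex exactly once. *)
Definition vertex_measure (mass : X -> R) : {measure set X -> \bar R} :=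
  atomic_measure (fun k => oapp mass 0 (pickle_inv k)) (fun k => odflt (Circ ord0) (pickle_inv k)).

Lemma vertex_measure1 mass x : (forall x, 0 <= mass x) -> vertex_measure mass [set x] = (mass x)%:E.
Proof.
move=> m0.
have s0 (k : nat) : 0 <= oapp mass 0 (pickle_inv (T:=X) k) by case: (pickle_inv k) => /=.
rewrite atomic_measureE// (@nneseriesD1 R _ (pickle x))//; last first.
  by move=> k _; rewrite lee_fin mulr_ge0.
rewrite pickleK_inv/= indicE mem_set// mulr1 eseries0 ?adde0// => k _ /=.
move=> kx; case E : (pickle_inv k) => [y|]/=; last by rewrite mul0r.
rewrite indicE memNset ?mulr0// => /= yx; move/eqP: kx; apply.
by have := @pickle_invK X k; rewrite E/= yx.
Qed.

Lemma vertex_measure_discrete mass : (forall x, 0 < mass x) -> discrete_measure (vertex_measure mass).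
Proof.
move=> m0; have m0' x := ltW (m0 x); split; last by move=> x; rewrite vertex_measure1// lte_fin.
exists (fun k => [set x : X | pickle x = k]).
  by apply/seteqP; split => // x _; exists (pickle x).
move=> k; split => //.
have [[x xk]|nF] := pselect (exists x : X, pickle x = k).
  apply: (@le_lt_trans _ _ (vertex_measure mass [set x])); last by rewrite vertex_measure1// ltry.
  apply: le_measure; rewrite ?inE// => y /=; rewrite -xk; exact: (pcan_inj pickleK).
rewrite (_ : [set x | _] = set0) ?measure0//.
by apply/seteqP; split => // x Fx; apply: nF; exists x.
Qed.

Lemma iter_phi_Branch n (i : branch_index eta) j :
  iter n (@phi kappa eta) @^-1` [set Branch i j] = [set Branch i (j + n)].
Proof.
elim: n j => [|n ih] j; first by rewrite addn0.
rewrite (_ : _ @^-1` _ = iter n phi @^-1` (phi @^-1` [set Branch i j]))//.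
suff -> : @phi kappa eta @^-1` [set Branch i j] = [set Branch i j.+1].
  by rewrite ih addSnnS.
apply/seteqP; split=> [[[[|r] hr]|i' [|j']]|x ->]//=.
by move=> [-> ->].
Qed.

Lemma phi_Circ_lt (r : 'I_kappa.+1) (hr : (r.+1 < kappa.+1)%N) :
  @phi kappa eta @^-1` [set Circ r] = [set Circ (Ordinal hr)].
Proof.
apply/seteqP; split=> [[[[|s] hs]|i [|j]]|x ->]//=.
- by move=> [] /(congr1 val)/= e; exfalso; have := hr; rewrite -e ltnn.
- move=> [] /(congr1 val)/=; rewrite inordK ?(ltnW hs)// => e.
  by congr Circ; apply: val_inj; rewrite /= e.
- by move=> [] /(congr1 val)/= e; exfalso; have := hr; rewrite -e ltnn.
- by congr Circ; apply: val_inj; rewrite /= inordK// ltnW.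
Qed.

Lemma phi_Circ_max :
  @phi kappa eta @^-1` [set Circ ord_max] =
  [set Circ ord0] `|` [set Branch i 0%N | i in [set: branch_index eta]].
Proof.
apply/seteqP; split=> [[[[|s] hs]|i [|j]]|x]//=.
- by move=> _; left; congr Circ; apply: val_inj.
- move=> [] /(congr1 val)/=; rewrite inordK ?(ltnW hs)// => e.
  by exfalso; have := hs; rewrite e ltnn.
- by move=> _; right; exists i.
- by move=> [->//|[i _ <-]].
Qed.

End vertex_measures.

(** * Powers of the composition operator *)

(** All functions on the vertex set are admissible, so membership in [L2] is
    finiteness of [sqnorm]. *)
Section composition.
Context {R : realType} {kappa : nat} {eta : option nat}.
Local Notation X := (vertex kappa eta).
Local Notation borelR := (measurableTypeR R).
Local Notation normc := ComplexField.Normc.normc.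
Variables (m : {measure set X -> \bar R}).
Implicit Types (f g : X -> R[i]).

Definition sqnorm f : \bar R := (\int[m]_x ((normc (f x)) ^+ 2)%:E)%E.

Lemma normc_ge0 (z : R[i]) : 0 <= normc z.
Proof. by case: z => a b; rewrite /= sqrtr_ge0. Qed.

Lemma normc0 : normc (0 : R[i]) = 0.
Proof. by rewrite /= expr0n/= addr0 sqrtr0. Qed.

Lemma L2norm_ge0 f : (0 <= L2norm m f)%E.
Proof. exact: Lnorm_ge0. Qed.

Lemma L2norm_sqr f : (L2norm m f ^+ 2)%E = sqnorm f.
Proof.
have sqrE (y : \bar R) : (0 <= y)%E -> (y ^+ 2 = y `^ 2)%E.
  case: y => [r| |]// r0.
    by rewrite expe2 -EFinM poweR_EFin powR_mulrn// expr2.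
  by rewrite expe2 mulyy poweRyr.
rewrite sqrE ?L2norm_ge0// /L2norm poweR_Lnorm//.
apply: eq_integral => x _ /=.
by rewrite ger0_norm ?normc_ge0// powR_mulrn// normc_ge0.
Qed.

Lemma L2P f : L2 m f <-> (sqnorm f < +oo)%E.
Proof.
rewrite /L2/= -L2norm_sqr; have := L2norm_ge0 f.
case: (L2norm m f) => [r| |]// r0.
by rewrite expe2 -EFinM !ltry.
Qed.

Lemma iter_composition n f : iter n (composition_operator m) f = f \o iter n phi.
Proof.
elim: n => [|n ih]; first by [].
by rewrite iterS ih; apply/funext => x /=; rewrite -iterSr.
Qed.

Lemma dom_powerP n f : dom_power m (composition_operator m) n f <->
  forall k, (k <= n)%N -> L2 m (f \o iter k phi).
Proof.
elim: n f => [|n ih] f /=.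
  by split => [h k|/(_ 0%N)]; [rewrite leqn0 => /eqP ->|exact].
split=> [[[h0 h1]] /ih h [|k] kn|h].
- exact: h0.
- exact: (h k kn).
- split; first by split; [exact: (h 0%N)|exact: (h 1%N)].
  by apply/ih => k kn; exact: (h k.+1 kn).
Qed.

Lemma dom_inftyP f : dom_infty m (composition_operator m) f <->
  forall n, (sqnorm (f \o iter n phi) < +oo)%E.
Proof.
split=> [h n|h n _]; first by apply/L2P; apply: ((dom_powerP n f).1 (h n Logic.I)).
by apply/dom_powerP => k _; exact/L2P.
Qed.

Lemma sqnorm_comp n f : sqnorm (f \o iter n phi) =
  (\esum_(x in [set: X]) ((normc (f x) ^+ 2)%:E * m (iter n phi @^-1` [set x])))%E.
Proof.
have mphi : measurable_fun [set: X] (iter n (@phi kappa eta)) by [].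
have h x : (0 <= (normc (f x) ^+ 2)%:E)%E by rewrite lee_fin exprn_ge0// normc_ge0.
have := @ge0_integral_pushforward _ _ X X R _ mphi m setT
  (fun x => (normc (f x) ^+ 2)%:E) measurableT.
rewrite preimage_setT => e; apply: (etrans (esym (e _ _))) => //.
by rewrite ge0_integral_vertex.
Qed.


Hypothesis m_fin : forall n x, (m (iter n phi @^-1` [set x]) < +oo)%E.

Lemma sqnorm_blocks f : sqnorm f =
  (\sum_(k <oo) \int[m]_(x in [set x : X | pickle x = k]) ((normc (f x)) ^+ 2)%:E)%E.
Proof.
have FT : [set: X] = \bigcup_k [set x : X | pickle x = k].
  by apply/seteqP; split => // x _; exists (pickle x).
rewrite /sqnorm FT ge0_integral_bigcup//.
- by move=> x _; rewrite lee_fin exprn_ge0// normc_ge0.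
- by move=> i j _ _ [x [/= <- <-]].
Qed.

(** Truncations along the enumeration [pickle] are finitely supported, hence in
    the domain of all powers as soon as the fibres have finite measure. *)
Definition truncation f N : X -> R[i] := fun x => if (pickle x < N)%N then f x else 0.

Lemma truncation_dom_infty f N : dom_infty m (composition_operator m) (truncation f N).
Proof.
apply/dom_inftyP => n; rewrite sqnorm_comp.
pose D := [set x : X | (pickle x < N)%N].
have finD : finite_set D.
  apply: (@finite_preimage _ _ [set k | (k < N)%N] pickle).
    by move=> x y _ _; exact: (pcan_inj pickleK).
  exact: finite_II.
rewrite (_ : (fun x => _) = (fun x => if x \in D then
   ((normc (f x) ^+ 2)%:E * m (iter n phi @^-1` [set x]))%E else 0%E)); last first.
  apply/funext => x; rewrite /truncation.
  have -> : (x \in D) = (pickle x < N)%N by apply/idP/idP; rewrite inE.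
  by case: ifP => // _; rewrite normc0 expr0n mul0e.
rewrite -esum_mkcond esum_fset//; last first.
  by move=> x _; rewrite mule_ge0// lee_fin exprn_ge0// normc_ge0.
rewrite fsbig_finite//=; apply: lte_sum_pinfty => x _.
apply: lte_mul_pinfty => //; by rewrite lee_fin exprn_ge0// normc_ge0.
Qed.

Lemma dense_dom_infty : dense_in_L2 m (dom_infty m (composition_operator m)).
Proof.
move=> f /L2P Lf e e0.
pose t k := (\int[m]_(x in [set x : X | pickle x = k]) ((normc (f x)) ^+ 2)%:E)%E.
have t0 k : (0 <= t k)%E.
  by apply: integral_ge0 => x _; rewrite lee_fin exprn_ge0// normc_ge0.
have := Lf; rewrite sqnorm_blocks -/t => st.
have := nneseries_tail_cvg st (fun k _ => t0 k).
have e20 : 0 < e ^+ 2 by rewrite exprn_gt0.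
move=> /fine_cvgP[[N1 _ fin] /cvgrPdist_lt/(_ _ e20)[N2 _ hN]].
pose N := maxn N1 N2.
have /= := fin N (leq_maxl _ _); have /= := hN N (leq_maxr _ _).
rewrite sub0r normrN => tailN finN.
exists (truncation f N); first exact: truncation_dom_infty.
rewrite ltNge; apply/negP => le.
have : ((e ^+ 2)%:E <= sqnorm (fun x => f x - truncation f N x)%R)%E.
  rewrite -L2norm_sqr expe2 expr2 EFinM.
  by apply: lee_pmul => //; rewrite lee_fin ltW.
apply/negP; rewrite -ltNge; apply: le_lt_trans (_ : (\sum_(N <= k <oo) t k < _)%E); last first.
  by rewrite -(fineK finN) lte_fin; apply: le_lt_trans tailN; exact: ler_norm.
rewrite sqnorm_blocks (@nneseries_split _ _ 0 N); last first.
  by move=> k _; apply: integral_ge0 => x _; rewrite lee_fin exprn_ge0// normc_ge0.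
rewrite add0n big_nat big1 ?add0e; last first.
  move=> k /= kN; apply: integral0_eq => x /= xk.
  by rewrite /truncation xk kN subrr normc0 expr0n.
rewrite [leLHS]ereal_series [leRHS]ereal_series.
apply: lee_nneseries => [k _ _|k /= Nk].
  by apply: integral_ge0 => x _; rewrite lee_fin exprn_ge0// normc_ge0.
rewrite le_eqVlt; apply/orP; left; apply/eqP; apply: eq_integral => x.
by rewrite inE/= => xk; rewrite /truncation xk ltnNge Nk/= subr0.
Qed.

End composition.

(** * Mixtures of representing measures *)

Section mixture.
Context {R : realType} {kappa : nat} {eta : option nat}.
Local Notation X := (vertex kappa eta).
Local Notation borelR := (measurableTypeR R).
Local Notation normc := ComplexField.Normc.normc.

Lemma nneseries_vertex (h : X -> R) : (forall x, 0 <= h x) ->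
  (\sum_(k <oo) (oapp h 0 (pickle_inv k))%:E = \esum_(x in [set: X]) (h x)%:E)%E.
Proof.
move=> h0.
have s0 (k : nat) : 0 <= oapp (fun _ : X => 1 : R) 0 (pickle_inv k).
  by case: (pickle_inv k).
transitivity (\int[vertex_measure (fun _ : X => 1%R : R)]_x (h x)%:E)%E.
  rewrite ge0_integral_atomic_measure//.
  apply: eq_eseriesr => k _; case: (pickle_inv k) => [x|]/=.
    by rewrite mul1e.
  by rewrite mul0e.
rewrite ge0_integral_vertex//.
by apply: eq_esum => x _; rewrite vertex_measure1// mule1.
Qed.

Variable mass : X -> R.
Hypothesis mass_gt0 : forall x, 0 < mass x.
Local Notation m := (vertex_measure mass).

(** The square norm of the [n]-th iterate is the sum over the vertices [x] of
    [|f x| ^ 2 mu(x) h_n(x)].  Hence mixing representing measures of the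
    sequences [h(x)] with weights [|f x| ^ 2 mu(x)] yields a representing
    measure. *)
Lemma generates_stieltjes_of_hseq :
  (forall n x, (m (iter n phi @^-1` [set x]) < +oo)%E) ->
  (forall x, stieltjes_moment_sequence (hseq m x)) ->
  generates_stieltjes m (composition_operator m).
Proof.
move=> m_fin hS; split; first exact: dense_dom_infty.
move=> f /dom_inftyP hf.
have /choice[theta hth] := hS.
have th0 x : theta x [set` `]-oo, (0:R)[] = 0%E.
  by case: (hth x) => _ /supported_on_RplusP.
pose c x := normc (f x) ^+ 2 * mass x.
have c0 x : 0 <= c x by rewrite mulr_ge0 ?exprn_ge0 ?normc_ge0// ltW.
pose cc (k : nat) : R := oapp c 0 (pickle_inv k).
have cc0 k : 0 <= cc k by rewrite /cc; case: pickle_inv => /=.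
pose nu : {measure set borelR -> \bar R} :=
  mseries (fun k => mscale (NngNum (cc0 k)) (theta (odflt (Circ ord0) (pickle_inv k)))) 0.
have nu0 : nu [set` `]-oo, (0:R)[] = 0%E.
  by apply: eseries0 => k _ _; rewrite /= /mscale/= th0 mule0.
have absE n : (\int[nu]_t (`|t| ^+ n)%:E = sqnorm m (f \o iter n phi))%E.
  have mX := @measurable_fun_normX R n.
  rewrite ge0_integral_measure_series//.
  pose h x := normc (f x) ^+ 2 * fine (m (iter n phi @^-1` [set x])).
  have h0 x : 0 <= h x.
    by rewrite mulr_ge0 ?exprn_ge0 ?normc_ge0// fine_ge0.
  have m_num x : m (iter n phi @^-1` [set x]) \is a fin_num by rewrite ge0_fin_numE.
  rewrite sqnorm_comp.
  transitivity (\esum_(x in [set: X]) (h x)%:E)%E; last first.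
    by apply: eq_esum => x _; rewrite /h EFinM fineK.
  rewrite -nneseries_vertex//; apply: eq_eseriesr => k _.
  rewrite ge0_integral_mscale//.
  rewrite /= /cc; case: (pickle_inv k) => [x|] /=; last by rewrite mul0e.
  have [_ _ hx] := hth x.
  rewrite -moment_norm// -hx /hseq vertex_measure1; last by move=> y; rewrite ltW.
  rewrite inver gt_eqF// /h /c -[in LHS](fineK (m_num x)) -!EFinM; congr EFin.
  by field; rewrite gt_eqF.
exists nu; split.
- by move=> n; rewrite absE; exact: hf.
- exact/supported_on_RplusP.
- by move=> n; rewrite moment_norm// absE -L2norm_sqr iter_composition.
Qed.

End mixture.

(** * The measure on the graph *)

(** The nodes are distributed among the branches by [cl]; consecutive nodes go to
    different branches, so that every branch misses infinitely many of them. *)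
Section the_measure.
Context {R : realType}.
Local Notation borelR := (measurableTypeR R).
Variables (kappa : nat) (eta : option nat) (cl : nat -> branch_index eta).
Hypothesis cl_surj : forall i, exists k, cl k = i.
Hypothesis cl_alt : forall k, cl k != cl k.+1.
Local Notation X := (vertex kappa eta).
Local Notation lam := (dyadic (@node_scale R kappa)).
Local Notation pow2 := (dyadic (1 : R)).
Local Notation v := (@lam_mass R kappa).

Lemma esum_classes (f : nat -> \bar R) : (forall k, (0 <= f k)%E) ->
  (\esum_(i in [set: branch_index eta]) \sum_(k <oo) (if cl k == i then f k else 0)
   = \sum_(k <oo) f k)%E.
Proof.
move=> f0; rewrite nneseries_esumT//.
transitivity (\esum_(i in [set: branch_index eta]) \esum_(k in [set k | cl k = i]) f k)%E.
  apply: eq_esum => i _; rewrite nneseries_esumT; last by move=> k; case: ifP.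
  rewrite [RHS]esum_mkcond; apply: eq_esum => k _.
  have -> : (k \in [set k | cl k = i]) = (cl k == i) by apply/idP/eqP; rewrite inE.
  by [].
rewrite esum_esum//; apply: (reindex_esum _ _ (fun k => (cl k, k))).
split => //=; last by move=> [i k] [_ /= <-]; exists k.
by move=> k k' _ _ [].
Qed.

Definition in_class i : pred nat := fun k => cl k == i.

Definition branch_total i j : R :=
  nnsum (fun k => branch_mass kappa (in_class i) k * lam k ^+ j).

(** For [n <= kappa] the mass of the [n]-th vertex of the circuit; the formula
    for larger [n] gives the measures of the fibres of the iterates. *)
Definition circ_total (n : nat) : R :=
  nnsum (fun k => v k * lam k ^+ n / lam k ^+ kappa) - 1.

Definition graph_mass (x : X) : R :=
  match x with Circ r => circ_total r | Branch i j => branch_total i j end.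

Lemma lam_gt0 k : 0 < lam k.
Proof. exact: lt_trans ltr01 (lam_gt1 kappa k). Qed.

Let lam_ge0 k : 0 <= lam k. Proof. exact/ltW/lam_gt0. Qed.
Let v_ge0 k : 0 <= v k. Proof. exact/ltW/lam_mass_gt0. Qed.

Lemma branch_summable i j :
  nnsummable (fun k => branch_mass kappa (in_class i) k * lam k ^+ j).
Proof.
apply: nnsummable_le (lam_mass_summable kappa j.+1) => k.
rewrite mulr_ge0 ?branch_mass_ge0 ?exprn_ge0//= exprS mulrA.
by rewrite ler_wpM2r ?exprn_ge0// branch_mass_le.
Qed.

Lemma circ_summable n : nnsummable (fun k => v k * lam k ^+ n / lam k ^+ kappa).
Proof.
apply: nnsummable_le (lam_mass_summable kappa n) => k.
rewrite !mulr_ge0 ?invr_ge0 ?exprn_ge0//= ler_piMr ?mulr_ge0 ?exprn_ge0//.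
by rewrite invf_le1 ?exprn_gt0 ?lam_gt0// exprn_ege1// ltW// lam_gt1.
Qed.

Lemma branch_mass_class_gt0 k : (0 : R) < branch_mass kappa (in_class (cl k)) k.
Proof.
rewrite /branch_mass /in_class eqxx.
by rewrite mulr_gt0 ?lam_mass_gt0 ?lam_gap_gt0.
Qed.

Lemma branch_total_gt0 i j : 0 < branch_total i j.
Proof.
have [k <-] := cl_surj i.
apply: lt_le_trans (nnsum_ge_term k (branch_summable _ _)).
by rewrite mulr_gt0 ?exprn_gt0 ?lam_gt0 ?branch_mass_class_gt0.
Qed.

Lemma circ_total_gt0 n : 0 < circ_total n.
Proof.
rewrite /circ_total subr_gt0; apply: (lt_le_trans (@lam_mass_neg_moment R kappa)).
apply: nnsum_le (circ_summable n) => k.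
rewrite mulr_ge0 ?invr_ge0 ?exprn_ge0//= ler_wpM2r ?invr_ge0 ?exprn_ge0//.
by rewrite ler_peMr// exprn_ege1// ltW// lam_gt1.
Qed.

Lemma graph_mass_gt0 x : 0 < graph_mass x.
Proof. by case: x => [r|i j] /=; [exact: circ_total_gt0|exact: branch_total_gt0]. Qed.

Let mass_ge0 x : 0 <= graph_mass x. Proof. exact/ltW/graph_mass_gt0. Qed.

Definition graph_measure : {measure set X -> \bar R} := vertex_measure graph_mass.
Local Notation mu := graph_measure.

Lemma graph_measure1 x : mu [set x] = (graph_mass x)%:E.
Proof. exact: vertex_measure1. Qed.

Lemma esum_branch_total (f : nat -> R) : (forall k, 0 <= f k) ->
  (\esum_(i in [set: branch_index eta])
     \sum_(k <oo) (branch_mass kappa (in_class i) k * f k)%:E =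
   \sum_(k <oo) (v k * (lam k - (lam k ^+ kappa)^-1) * f k)%:E)%E.
Proof.
move=> f0; rewrite -esum_classes; last first.
  by move=> k; rewrite lee_fin !mulr_ge0// ltW// lam_gap_gt0.
apply: eq_esum => i _; apply: eq_eseriesr => k _.
by rewrite /branch_mass /in_class; case: ifP => //; rewrite mul0r.
Qed.

Lemma graph_measure_Branch n i j :
  mu (iter n phi @^-1` [set Branch i j]) = (branch_total i (j + n))%:E.
Proof. by rewrite iter_phi_Branch graph_measure1. Qed.

(** Since [lam - lam ^ (- kappa) = lam ^ (- kappa) (lam ^ (kappa + 1) - 1)], one
    turn around the circuit telescopes. *)
Lemma circ_total_step n : ((circ_total n)%:E +
  \esum_(i in [set: branch_index eta]) (branch_total i n)%:E)%E =
  (circ_total (n + kappa.+1))%:E.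
Proof.
rewrite (eq_esum (b := fun i => (\sum_(k <oo)
   (branch_mass kappa (in_class i) k * lam k ^+ n)%:E)%E)); last first.
  by move=> i _; rewrite nnsumE//; exact: branch_summable.
rewrite esum_branch_total; last by move=> k; rewrite exprn_ge0.
have s : nnsummable (fun k => v k * (lam k - (lam k ^+ kappa)^-1) * lam k ^+ n).
  apply: nnsummable_le (lam_mass_summable kappa n.+1) => k.
  rewrite !mulr_ge0 ?exprn_ge0 ?(ltW (lam_gap_gt0 _ _))//= exprS mulrA.
  by rewrite ler_wpM2r ?exprn_ge0// ler_wpM2l// gerBl invr_ge0 exprn_ge0.
rewrite nnsumE// -EFinD /circ_total addrAC -nnsumD//; last exact: circ_summable.
congr (_ - 1)%:E; apply: eq_nnsum => k.
by rewrite exprD exprS; field; rewrite expf_neq0 ?gt_eqF// lam_gt0.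
Qed.

(** Passing from [n] to [n + 1] moves one vertex ahead on the circuit, except at
    [Circ ord_max], where the branches join in. *)
Lemma graph_measure_Circ n (r : 'I_kappa.+1) :
  mu (iter n phi @^-1` [set Circ r]) = (circ_total (n + r))%:E.
Proof.
elim: n r => [|n ih] r; first by rewrite graph_measure1.
rewrite (_ : _ @^-1` _ = iter n phi @^-1` (phi @^-1` [set Circ r]))//.
have [hr|hr] := ltnP r.+1 kappa.+1.
  by rewrite (phi_Circ_lt hr) ih/= addSnnS.
have -> : r = ord_max.
  by apply: val_inj => /=; have := ltn_ord r; lia.
rewrite phi_Circ_max preimage_setU.
have -> : iter n phi @^-1` [set Branch i 0%N | i in [set: branch_index eta]]
   = [set Branch i n | i in [set: branch_index eta]] :> set X.
  apply/seteqP; split=> x /=.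
    move=> [i _ e].
    have : (iter n (@phi kappa eta) @^-1` [set Branch i 0%N]) x by rewrite /= e.
    by rewrite iter_phi_Branch => ->; exists i.
  move=> [i _ <-]; exists i => //.
  have : (iter n (@phi kappa eta) @^-1` [set Branch i 0%N]) (Branch i n).
    by rewrite iter_phi_Branch.
  by move=> /= ->.
rewrite measureU//; last first.
  apply/seteqP; split => // x [/= h [i _ e]].
  have : (iter n (@phi kappa eta) @^-1` [set Branch i 0%N]) (Branch i n).
    by rewrite iter_phi_Branch.
  by rewrite /= e h.
rewrite addSnnS -circ_total_step; congr (_ + _)%E.
  by rewrite -[n in RHS]addn0; exact: (ih ord0).
rewrite [LHS]measure_vertex esum_image; last by move=> i i' _ _ [].
by apply: eq_esum => i _; rewrite graph_measure1.
Qed.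

Lemma graph_measure_fin n x : (mu (iter n phi @^-1` [set x]) < +oo)%E.
Proof. by case: x => [r|i j]; rewrite ?graph_measure_Circ ?graph_measure_Branch ltry. Qed.

Lemma hseqE x n : hseq mu x n = ((graph_mass x)^-1 * fine (mu (iter n phi @^-1` [set x])))%:E.
Proof.
rewrite /hseq graph_measure1 inver gt_eqF ?graph_mass_gt0// -[X in (X * _)%E]fineK.
  by rewrite -EFinM mulrC.
by rewrite ge0_fin_numE// graph_measure_fin.
Qed.

Definition branch_nu i j : {measure set borelR -> \bar R} :=
  @atomic_measure R _ borelR (fun k => (branch_total i j)^-1 * branch_mass kappa (in_class i) k * lam k ^+ j) lam.

Definition circ_nu : {measure set borelR -> \bar R} :=
  @atomic_measure R _ borelR (fun k => (circ_total kappa)^-1 * tail_mass kappa k) pow2.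

Let branch_w_ge0 i j p k :
  0 <= (branch_total i j)^-1 * branch_mass kappa (in_class i) k * lam k ^+ p.
Proof.
by rewrite !mulr_ge0 ?invr_ge0 ?exprn_ge0 ?branch_mass_ge0// ltW ?branch_total_gt0.
Qed.

Lemma hseq_Branch i j : hseq mu (Branch i j) = moment (branch_nu i j).
Proof.
apply/funext => n; rewrite hseqE graph_measure_Branch/= moment_atomic_measure//.
rewrite /branch_total -nnsumZ; last 2 first.
- by rewrite invr_ge0 ltW// branch_total_gt0.
- exact: branch_summable.
rewrite -nnsumE; last first.
  apply: nnsummableZ; last exact: branch_summable.
  by rewrite invr_ge0 ltW// branch_total_gt0.
by apply: eq_eseriesr => k _; rewrite exprD -/(branch_total i j) !mulrA.
Qed.

(** Up to normalisation the sequence is the moment sequence of [nu] minus 1,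
    where [nu] has the masses [lam_mass].  Exchanging [nu] for the measure on
    the powers of 2 with the same moments turns the subtracted 1 into the
    removal of the atom at 1. *)
Lemma hseq_Circ_max : hseq mu (Circ ord_max) = moment circ_nu.
Proof.
apply/funext => n; rewrite hseqE graph_measure_Circ/= tail_mass_moment; last first.
  by rewrite invr_ge0 ltW// circ_total_gt0.
congr EFin; congr (_ * (_ - _)); apply: eq_nnsum => k.
by rewrite exprD mulrA mulfK// expf_neq0// gt_eqF// lam_gt0.
Qed.

Lemma in_class_alt i k : ~~ in_class i k || ~~ in_class i k.+1.
Proof.
rewrite /in_class -negb_and; apply/negP => /andP[/eqP h /eqP h'].
by have := cl_alt k; rewrite h h' eqxx.
Qed.

Lemma branch_nu_determinate i j : H_determinate_measure (branch_nu i j).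
Proof.
apply: branch_mass_determinate; last exact: in_class_alt.
by rewrite invr_ge0 ltW// branch_total_gt0.
Qed.

Lemma branch_nu_index i j : index_at 0 (branch_nu i j) = +oo%E.
Proof.
apply: index_at_infinite => // p.
rewrite (_ : (fun k => _) = (fun k => (branch_total i j)^-1 * branch_mass kappa (in_class i) k
   * lam k ^+ (j + 2 * p))); last by apply/funext => k; rewrite exprD !mulrA.
apply: branch_mass_determinate; last exact: in_class_alt.
by rewrite invr_ge0 ltW// branch_total_gt0.
Qed.

Lemma hseq_Branch_props i j :
  S_representing (hseq mu (Branch i j)) (branch_nu i j) /\
  H_determinate (hseq mu (Branch i j)) /\ infinite_index (hseq mu (Branch i j)).
Proof.
have [fm det] := branch_nu_determinate i j.
rewrite hseq_Branch; split; last split => //.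
  by split => //; apply/supported_on_RplusP; exact: atomic_measure_Rplus.
by exists 0, (branch_nu i j) => //; exact: branch_nu_index.
Qed.

Lemma hseq_Circ_max_props :
  [/\ stieltjes_moment_sequence (hseq mu (Circ ord_max)),
      H_determinate (hseq mu (Circ ord_max)) &
      sequence_index (hseq mu (Circ ord_max)) 0 0%E].
Proof.
have c0 : 0 < (circ_total kappa)^-1 by rewrite invr_gt0 circ_total_gt0.
have [fm det] := tail_mass_determinate kappa (ltW c0).
rewrite hseq_Circ_max; split => //.
- exists circ_nu; split => //; apply/supported_on_RplusP; apply: atomic_measure_Rplus.
    by move=> k; rewrite mulr_ge0 ?tail_mass_ge0 ?(ltW c0).
  by move=> k; rewrite (le_trans ler01) ?pow2_ge1.
- by exists circ_nu => //; exact: tail_mass_index.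
Qed.

End the_measure.

(** * Densities and probabilities *)

Section density.
Context d (T : measurableType d) (R : realType).
Variables (m1 m2 : {measure set T -> \bar R}) (h : T -> R).
Hypothesis h_ge0 : forall x, 0 <= h x.
Hypothesis mh : measurable_fun setT h.
Hypothesis m1E : forall A, measurable A -> m1 A = (\int[m2]_(x in A) (h x)%:E)%E.
Import HBNNSimple.

Lemma ge0_integral_density (f : T -> \bar R) : (forall x, (0 <= f x)%E) ->
  measurable_fun setT f -> (\int[m1]_x f x = \int[m2]_x (f x * (h x)%:E))%E.
Proof.
move=> f0 mf; pose g := nnsfun_approx measurableT mf.
have gf x : (g n x)%:E @[n --> \oo] --> f x by exact: cvg_nnsfun_approx.
have mhE : measurable_fun setT (fun x => (h x)%:E) by exact/measurable_EFinP.
have simple (u : {nnsfun T >-> R}) :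
    (\int[m1]_x (u x)%:E = \int[m2]_x ((u x)%:E * (h x)%:E))%E.
  rewrite integralT_nnsfun sintegralE.
  transitivity (\int[m2]_x (\sum_(r \in range u)
      (r%:E * ((\1_(u @^-1` [set r]) x)%:E * (h x)%:E)))%E)%E; last first.
    apply: eq_integral => x _; rewrite [in RHS]fimfunE -fsumEFin//.
    rewrite ge0_mule_fsuml; last by move=> r; rewrite nnfun_muleindic_ge0.
    by apply: eq_fsbigr => r _; rewrite EFinM muleA.
  have mi r : measurable_fun setT (fun x => (\1_(u @^-1` [set r]) x)%:E * (h x)%:E)%E.
    by apply: emeasurable_funM => //; exact/measurable_EFinP.
  rewrite ge0_integral_fsum//; last 2 first.
  - by move=> r; apply: emeasurable_funM.
  - by move=> r x _; rewrite muleA; apply: mule_ge0; [exact: nnfun_muleindic_ge0|rewrite lee_fin].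
  apply: eq_fsbigr => r /[!inE] -[x _ <-].
  rewrite ge0_integralZl ?lee_fin//; last first.
    by move=> y _; rewrite mule_ge0 ?lee_fin.
  congr (_ * _)%E; rewrite m1E// integral_mkcond; apply: eq_integral => y _.
  by rewrite patchE indicE; case: ifP; rewrite ?mul1e ?mul0e.
have -> : (\int[m1]_x f x = limn (fun n => \int[m1]_x (g n x)%:E))%E.
  rewrite -monotone_convergence//.
  - by apply: eq_integral => x _; apply/esym/cvg_lim.
  - by move=> n; exact/measurable_EFinP.
  - by move=> n x _; rewrite lee_fin.
  - by move=> x _ i j ij; rewrite lee_fin; exact/lefP/nd_nnsfun_approx.
have -> : (\int[m2]_x (f x * (h x)%:E) =
    limn (fun n => \int[m2]_x ((g n x)%:E * (h x)%:E)))%E.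
  rewrite -monotone_convergence//.
  - by apply: eq_integral => x _; apply/esym/cvg_lim => //; exact: cvgeZr.
  - by move=> n; apply: emeasurable_funM => //; exact/measurable_EFinP.
  - by move=> n x _; rewrite mule_ge0// lee_fin.
  - move=> x _ i j ij; rewrite lee_wpmul2r ?lee_fin//.
    exact/lefP/nd_nnsfun_approx.
by congr (limn _); apply/funext => n; exact: simple.
Qed.

End density.

Section probability_of.
Context {R : realType}.
Local Notation borelR := (measurableTypeR R).
Variables (nu : {measure set borelR -> \bar R}) (nu1 : nu setT = 1%E).

(** The proof is an argument of this alias of [nu] so that the instance below
    can be attached to it. *)
Definition probability_of of nu setT = 1%E : set borelR -> \bar R := nu.

HB.instance Definition _ := Measure.copy (probability_of nu1) nu.

HB.instance Definition _ :=
  Measure_isProbability.Build _ borelR R (probability_of nu1) nu1.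

End probability_of.

(** * The representing family on the branches *)

Section representing_family.
Context {R : realType}.
Local Notation borelR := (measurableTypeR R).
Variables (kappa : nat) (eta : option nat) (cl : nat -> branch_index eta).
Hypothesis cl_surj : forall i, exists k, cl k = i.
Hypothesis cl_alt : forall k, cl k != cl k.+1.
Local Notation X := (vertex kappa eta).
Local Notation lam := (dyadic (@node_scale R kappa)).
Local Notation v := (@lam_mass R kappa).
Local Notation mu := (@graph_measure R kappa eta cl).
Local Notation branch_total := (@branch_total R kappa eta cl).
Local Notation circ_total := (@circ_total R kappa).
Local Notation branch_nu := (@branch_nu R kappa eta cl).

Lemma measurable_cyc_integrand (num : R -> R) : continuous num ->
  measurable_fun [set` `](1:R), +oo[] (fun t : borelR => num t / (t ^+ kappa.+1 - 1)).
Proof.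
move=> cnum; apply: open_continuous_measurable_fun; first exact: interval_open.
move=> t; rewrite inE/= in_itv/= andbT => t1.
apply: cvgM; first exact: cnum.
apply: cvgV; first by rewrite subr_eq0 gt_eqF// exprn_egt1.
apply: cvgB; last exact: cvg_cst.
exact: exprn_continuous.
Qed.

Lemma branch_nuT i : branch_nu i 0 setT = 1%E.
Proof.
rewrite -moment0 -(hseq_Branch kappa cl_surj) hseqE// graph_measure_Branch// addn0 /=.
by rewrite mulVf// gt_eqF// branch_total_gt0.
Qed.

Definition branch_prob i : probability borelR R := probability_of (branch_nuT i).

Lemma branch_probE i : measure_eq (branch_nu i 0) (branch_prob i).
Proof. by []. Qed.

Lemma cyc_integral_branch i (num : R -> R) : continuous num ->
  (forall t, 1 < t -> 0 <= num t) ->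
  (mu [set Branch i 0%N] * cyc_integral (kappa := kappa) branch_prob i num =
   \sum_(k <oo) (branch_mass kappa (in_class cl i) k *
     (num (lam k) / (lam k ^+ kappa.+1 - 1)))%:E)%E.
Proof.
move=> cnum num0.
have bt0 : 0 < branch_total i 0 by exact: branch_total_gt0.
pose D : set borelR := [set` `](1:R), +oo[].
pose F (t : borelR) := ((num t / (t ^+ kappa.+1 - 1))%:E : \bar R).
have F0 t : D t -> (0 <= F t)%E.
  rewrite /D/= in_itv/= andbT => t1.
  by rewrite lee_fin divr_ge0 ?num0// subr_ge0 exprn_ege1// ltW.
have mD : measurable D by exact: measurable_itv.
have mF : measurable_fun D F.
  by apply/measurable_EFinP; exact: measurable_cyc_integrand.
have w0 k : 0 <= (branch_total i 0)^-1 * branch_mass kappa (in_class cl i) k * lam k ^+ 0.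
  by rewrite expr0 mulr1 mulr_ge0 ?invr_ge0 ?branch_mass_ge0// ltW.
have -> : cyc_integral (kappa := kappa) branch_prob i num =
    (\int[branch_nu i 0]_(t in D) F t)%E by [].
rewrite integral_mkcond ge0_integral_atomic_measure//; last 2 first.
- exact/(measurable_restrictT _ mD).
- by move=> t; rewrite patchE; case: ifPn => //; rewrite inE => /F0.
rewrite graph_measure1// -nneseriesZl; last first.
  move=> k _; rewrite mule_ge0 ?lee_fin ?w0// patchE; case: ifPn => //.
  by rewrite inE => /F0.
apply: eq_eseriesr => k _; rewrite patchE ifT; last first.
  by rewrite inE /D/= in_itv/= andbT lam_gt1.
rewrite -!EFinM /=; congr EFin.
by rewrite expr0 mulr1 !mulrA mulfV ?gt_eqF// mul1r.
Qed.

(** The factor [t ^ (kappa + 1) - 1] cancels against the one in [branch_mass],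
    and the branches together carry every node once. *)
Lemma esum_cyc_integral (num : R -> R) : continuous num ->
  (forall t, 1 < t -> 0 <= num t) ->
  (\esum_(i in [set: branch_index eta])
    (mu [set Branch i 0%N] * cyc_integral (kappa := kappa) branch_prob i num) =
   \sum_(k <oo) (v k * (num (lam k) / lam k ^+ kappa))%:E)%E.
Proof.
move=> cnum num0.
rewrite (eq_esum (b := fun i => (\sum_(k <oo) (branch_mass kappa (in_class cl i) k *
     (num (lam k) / (lam k ^+ kappa.+1 - 1)))%:E)%E)); last first.
  by move=> i _; exact: cyc_integral_branch.
rewrite esum_branch_total; last first.
  move=> k; rewrite divr_ge0 ?num0 ?lam_gt1// subr_ge0 exprn_ege1//.
  by rewrite ltW// lam_gt1.
apply: eq_eseriesr => k _; congr EFin.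
have l1 := @lam_gt1 R kappa k; have l0 := @lam_gt0 R kappa k.
have d0 : lam k ^+ kappa.+1 - 1 != 0 by rewrite subr_eq0 gt_eqF// exprn_egt1.
rewrite exprS in d0 *.
by field; rewrite d0 andbT expf_neq0// gt_eqF.
Qed.

Lemma esum_cyc_integral_div (c : R) (num : R -> R) : 0 < c -> continuous num ->
  (forall t, 1 < t -> 0 <= num t) ->
  (\esum_(i in [set: branch_index eta])
    (mu [set Branch i 0%N] / c%:E * cyc_integral (kappa := kappa) branch_prob i num) =
   c^-1%:E * \sum_(k <oo) (v k * (num (lam k) / lam k ^+ kappa))%:E)%E.
Proof.
move=> c0 cnum num0.
have cc : continuous (fun t => c^-1 * num t).
  by move=> t; apply: cvgM; [exact: cvg_cst|exact: cnum].
rewrite (eq_esum (b := fun i => (mu [set Branch i 0%N] *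
   cyc_integral (kappa := kappa) branch_prob i (fun t => (c^-1 * num t)%R))%E)).
  rewrite esum_cyc_integral//; last first.
    by move=> t t1; rewrite mulr_ge0 ?num0// invr_ge0 ltW.
  rewrite -nneseriesZl; last first.
    move=> k _; rewrite lee_fin mulr_ge0 ?(ltW (@lam_mass_gt0 R kappa _))//.
    by rewrite divr_ge0 ?num0 ?lam_gt1// exprn_ge0// ltW// lam_gt0.
  by apply: eq_eseriesr => k _; rewrite -EFinM; congr EFin; ring.
move=> i _; rewrite inver gt_eqF// -muleA; congr (_ * _)%E.
rewrite /cyc_integral -ge0_integralZl//; last 3 first.
- by apply/measurable_EFinP; exact: measurable_cyc_integrand.
- move=> t /=; rewrite in_itv/= andbT => t1.
  by rewrite lee_fin divr_ge0 ?num0// subr_ge0 exprn_ege1// ltW.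
- by rewrite lee_fin invr_ge0 ltW.
by apply: eq_integral => t _; rewrite -EFinM mulrA.
Qed.

Lemma branch_prob_family : family_bcd' mu branch_prob.
Proof.
split.
- move=> i; have [[_ h _] _] := @hseq_Branch_props R kappa eta cl cl_surj cl_alt i 0.
  exact: h.
- move=> i; split.
    apply: (S_representing_eq (@branch_probE i)).
    exact: (@hseq_Branch_props R kappa eta cl cl_surj cl_alt i 0).1.
  apply: atomic_measure_null.
    move=> k; rewrite expr0 mulr1 mulr_ge0 ?invr_ge0 ?branch_mass_ge0//.
    by rewrite ltW// branch_total_gt0.
  by move=> k /=; rewrite in_itv/= leNgt (leNgt _ 1) lam_gt1 andbF.
- move=> r r0; rewrite !graph_measure1//=.
  have c0 : 0 < circ_total r by exact: circ_total_gt0.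
  rewrite esum_cyc_integral_div//; last 2 first.
  - move=> t; apply: cvgB; last exact: cvg_cst.
    exact: exprn_continuous.
  - by move=> t t1; rewrite subr_ge0 exprn_ege1// ltW.
  have s : nnsummable (fun k => v k * ((lam k ^+ r - 1) / lam k ^+ kappa)).
    apply: nnsummable_le (circ_summable _ r) => k.
    have l1 := @lam_gt1 R kappa k; have l0 := @lam_gt0 R kappa k.
    rewrite mulr_ge0 ?(ltW (@lam_mass_gt0 R kappa _))//=; last first.
      by rewrite divr_ge0 ?exprn_ge0 ?(ltW l0)// subr_ge0 exprn_ege1// ltW.
    rewrite -[leRHS]mulrA; apply: ler_wpM2l; first exact: ltW (lam_mass_gt0 _ _).
    by rewrite ler_wpM2r ?invr_ge0 ?exprn_ge0 ?(ltW l0)// gerBl.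
  rewrite nnsumE// inver gt_eqF// -!EFinM -EFinD; congr EFin.
  have : nnsum (fun k => v k * ((lam k ^+ r - 1) / lam k ^+ kappa)) + circ_total 0 = circ_total r.
    rewrite /circ_total addrA -nnsumD//; last exact: circ_summable.
    by congr (_ - 1); apply: eq_nnsum => k; rewrite expr0; ring.
  by move=> e; rewrite [X in X + _]mulrC -mulrDl e mulfV// gt_eqF.
- rewrite /cond_d' esum_cyc_integral//; last exact: cst_continuous.
  rewrite (eq_eseriesr (g := fun k => (v k * lam k ^+ 0 / lam k ^+ kappa)%:E)).
    exact: (circ_summable _ 0).2.
  by move=> k _; rewrite expr0 mulr1 mul1r.
Qed.

(** The sum exceeds 1 because the circuit masses were obtained by subtracting
    1. *)
Lemma branch_prob_not_d : ~ cond_d mu branch_prob.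
Proof.
have c0 : 0 < circ_total 0 by exact: circ_total_gt0.
rewrite /cond_d graph_measure1//= esum_cyc_integral_div//; last exact: cst_continuous.
rewrite (eq_eseriesr (g := fun k => (v k * lam k ^+ 0 / lam k ^+ kappa)%:E)); last first.
  by move=> k _; rewrite expr0 mulr1 mul1r.
rewrite nnsumE; last exact: circ_summable.
rewrite -EFinM lee_fin ler_pdivrMl// mulr1.
by apply/negP; rewrite -ltNge /circ_total ltrBlDr ltrDl ltr01.
Qed.

End representing_family.

(** * Nonexistence of a consistent family *)

Section no_consistent_family.
Context {R : realType}.
Local Notation borelR := (measurableTypeR R).
Variables (kappa : nat) (eta : option nat) (cl : nat -> branch_index eta).
Hypothesis cl_surj : forall i, exists k, cl k = i.
Hypothesis cl_alt : forall k, cl k != cl k.+1.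
Local Notation X := (vertex kappa eta).
Local Notation lam := (dyadic (@node_scale R kappa)).
Local Notation v := (@lam_mass R kappa).
Local Notation mu := (@graph_measure R kappa eta cl).
Local Notation mass := (@graph_mass R kappa eta cl).
Local Notation branch_total := (@branch_total R kappa eta cl).
Local Notation circ_total := (@circ_total R kappa).
Local Notation branch_nu := (@branch_nu R kappa eta cl).

Variable P : X -> probability borelR R.
Hypothesis P_supp : forall x, supported_on_Rplus (P x).
Hypothesis P_cc : consistency_condition mu P.

Let P_neg x : P x [set` `]-oo, (0:R)[] = 0%E.
Proof. exact/supported_on_RplusP. Qed.

Let mass0 (x : X) : 0 < mass x. Proof. exact: graph_mass_gt0. Qed.

Lemma consistency_single (x z : X) (s : set borelR) :
  @phi kappa eta @^-1` [set x] = [set z] -> measurable s -> s `<=` `[0, +oo[ ->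
  ((mass z / mass x)%:E * P z s = \int[P x]_(t in s) t%:E)%E.
Proof.
move=> xz ms s0.
have xr : range (@phi kappa eta) x.
  by exists z => //; have : [set z] z by []; rewrite -xz.
rewrite -(P_cc ms s0 xr) xz esum_set1; last by rewrite mule_ge0.
by rewrite !graph_measure1// inver gt_eqF// muleA -EFinM mulrC.
Qed.

(** Consistency says that the measure at [z] is, up to a constant, the one at [x]
    with density [t]; only its restriction to the half-line matters. *)
Lemma consistency_moment (x z : X) n : @phi kappa eta @^-1` [set x] = [set z] ->
  ((mass z / mass x)%:E * \int[P z]_t (`|t| ^+ n)%:E = \int[P x]_t (`|t| ^+ n.+1)%:E)%E.
Proof.
move=> xz.
have c0 : 0 <= mass z / mass x by rewrite divr_ge0// ltW.
pose h (t : borelR) : R := Num.max t 0.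
have mh : measurable_fun setT h.
  by apply: measurable_maxr => //; exact: measurable_id.
have h0 t : 0 <= h t by rewrite le_max lexx orbT.
pose m1 : {measure set borelR -> \bar R} := mscale (NngNum c0) (P z).
have m1E A : measurable A -> m1 A = (\int[P x]_(t in A) (h t)%:E)%E.
  move=> mA.
  have mI : measurable (A `&` [set` `[(0:R), +oo[]).
    by apply: measurableI => //; exact: measurable_itv.
  have mN : measurable (A `&` [set` `]-oo, (0:R)[]).
    by apply: measurableI => //; exact: measurable_itv.
  have -> : m1 A = ((mass z / mass x)%:E * P z A)%E by [].
  have {1}-> : A = (A `&` [set` `[(0:R), +oo[]) `|` (A `&` [set` `]-oo, (0:R)[]).
    apply/seteqP; split => t /=; last by case=> -[].
    by rewrite !in_itv/= andbT => At; case: (leP 0 t); [left|right].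
  rewrite measureU0//; last first.
    by apply: (@subset_measure0 _ _ _ (P z) _ [set` `]-oo, (0:R)[]);
      [exact: mN|exact: measurable_itv|move=> t []|exact: P_neg].
  rewrite (consistency_single xz)//.
  rewrite integral_mkcond [RHS]integral_mkcond; apply: eq_integral => t _.
  rewrite !patchE in_setI; case: (t \in A) => //=.
  have -> : (t \in [set` `[(0:R), +oo[]) = (0 <= t).
    by apply/idP/idP; rewrite inE/= in_itv/= andbT.
  by rewrite /h; case: (leP 0 t).
have mX k := @measurable_fun_normX R k.
have X0 k (t : borelR) : (0 <= (`|t| ^+ k)%:E)%E by rewrite lee_fin exprn_ge0.
transitivity (\int[m1]_t (`|t| ^+ n)%:E)%E.
  by rewrite ge0_integral_mscale.
rewrite (@ge0_integral_density _ borelR R m1 (P x) h)//.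
apply: ae_eq_integral => //.
  by apply: emeasurable_funM => //; exact/measurable_EFinP.
exists [set` `]-oo, (0:R)[]; split; [exact: measurable_itv|exact: P_neg|].
move=> t /= ht; rewrite in_itv/= ltNge; apply/negP => t0; apply: ht => _.
by rewrite -EFinM exprSr (ger0_norm t0) /h; move: t0; case: leP.
Qed.

Lemma phi_Branch i j : @phi kappa eta @^-1` [set Branch i j] = [set Branch i j.+1].
Proof. by have := @iter_phi_Branch kappa eta 1 i j; rewrite addn1. Qed.

Lemma consistency_branch_moment i j n :
  (\int[P (Branch i j)]_t (`|t| ^+ n)%:E)%E =
  (branch_total i (j + n) / branch_total i j)%:E.
Proof.
have bt j0 : branch_total i j0 != 0.
  by have := mass0 (Branch i j0); rewrite /= => /lt0r_neq0.
elim: n j => [|n ih] j.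
  rewrite addn0 divff//; under eq_integral do rewrite expr0.
  by rewrite integral_cst// mul1e; exact: probability_setT.
rewrite -(consistency_moment n (phi_Branch i j)) ih -EFinM; congr EFin.
by rewrite /= addSnnS; field; rewrite !bt.
Qed.

(** Consistency along a branch forces the moments, and these are determinate. *)
Lemma consistent_branch i : measure_eq (branch_nu i 0) (P (Branch i 0%N)).
Proof.
have [[fm _ rep] [det _]] := @hseq_Branch_props R kappa eta cl cl_surj cl_alt i 0.
apply: (H_determinate_unique det) => //; split => n.
  by rewrite consistency_branch_moment ltry.
rewrite moment_norm; last exact: P_neg.
apply: (etrans _ (esym (consistency_branch_moment i 0 n))).
by rewrite hseqE// graph_measure_Branch//= mulrC.
Qed.

Lemma branch_nu_atom i k : branch_nu i 0 [set lam k] =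
  ((branch_total i 0)^-1 * branch_mass kappa (in_class cl i) k)%:E.
Proof.
have b0 : 0 <= branch_total i 0 by have := ltW (mass0 (Branch i 0%N)).
have a0 : 0 < @node_scale R kappa.
  by apply: lt_trans ltr01 _; case/andP: (@node_scale_bounds R kappa).
have w0 j : 0 <= (branch_total i 0)^-1 * branch_mass kappa (in_class cl i) j * lam j ^+ 0.
  by rewrite expr0 mulr1 mulr_ge0 ?invr_ge0 ?branch_mass_ge0.
rewrite atomic_measureE// (@nneseriesD1 R _ k)//; last first.
  by move=> j _; rewrite lee_fin mulr_ge0.
rewrite indicE mem_set// expr0 !mulr1 eseries0 ?adde0// => j _ /= jk.
rewrite indicE memNset ?mulr0//= => /(dyadic_inj a0) e.
by rewrite e eqxx in jk.
Qed.

(** At an atom [lam k] the consistency conditions around the circuit give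
    [circ_total 0 * P(x_0, {lam k}) = lam_mass k / lam k ^ kappa].  Summing over
    [k] contradicts [P(x_0, .) <= 1], for the same reason as in
    [branch_prob_not_d]. *)
Lemma no_consistent_family : False.
Proof.
pose p k (x : X) : R := fine (P x [set lam k]).
have pE k x : P x [set lam k] = (p k x)%:E.
  by rewrite fineK// fin_num_measure//; exact: measurable_set1.
have l0 k := @lam_gt0 R kappa k.
have l1 k := @lam_gt1 R kappa k.
have sub k : [set lam k] `<=` `[0, +oo[.
  by move=> t /= ->; rewrite in_itv/= andbT ltW.
have msg k : measurable ([set lam k] : set borelR) by exact: measurable_set1.
have atom k x : (\int[P x]_(t in [set lam k]) t%:E = (lam k * p k x)%:E)%E.
  rewrite (eq_integral (fun _ : borelR => (lam k)%:E)); last first.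
    by move=> t; rewrite inE => ->.
  by rewrite integral_cst// (EFinM (lam k)) -pE.
have circ0 r : 0 < circ_total r by exact: circ_total_gt0.
(* going around the circuit from [Circ ord0] *)
have chain k r (hr : (r < kappa.+1)%N) :
    circ_total r * p k (Circ (Ordinal hr)) =
    lam k ^+ r * (circ_total 0 * p k (Circ ord0)).
  elim: r hr => [|r ih] hr.
    by rewrite expr0 mul1r; congr (_ * p _ (Circ _)); apply: val_inj.
  have hr' : (r < kappa.+1)%N by exact: ltnW.
  have := consistency_single (phi_Circ_lt (r := Ordinal hr') hr) (msg k) (sub k).
  rewrite atom pE -EFinM => -[] /= e.
  rewrite exprS -mulrA -ih mulrCA -e mulrA; congr (_ * _).
  by rewrite mulrC divfK// gt_eqF.
(* closing the circuit, where the branches contribute the mass of [lam k] *)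
have top k : circ_total 0 * p k (Circ ord0) + v k * (lam k - (lam k ^+ kappa)^-1) =
    lam k ^+ kappa.+1 * (circ_total 0 * p k (Circ ord0)).
  have xr : range (@phi kappa eta) (Circ ord_max) by exists (Circ ord0).
  have := P_cc (msg k) (sub k) xr; rewrite atom phi_Circ_max.
  set A := _ `|` _.
  have -> : (\esum_(y in A) (mu [set y] * P y [set lam k]) =
    (circ_total 0 * p k (Circ ord0) + v k * (lam k - (lam k ^+ kappa)^-1))%:E)%E.
    rewrite (esumID [set Circ ord0]); last by move=> x _; rewrite mule_ge0.
    rewrite (_ : A `&` [set Circ ord0] = [set Circ ord0]); last first.
      by apply/seteqP; split => [x []//|x ->]; split => //; left.
    rewrite (_ : A `&` ~` [set Circ ord0] = [set Branch i 0%N | i in [set: branch_index eta]]); last first.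
      apply/seteqP; split => [x [[->|h] nx]|x [i _ <-]].
      - by case: nx.
      - exact: h.
      - by split => //; right; exists i.
    rewrite esum_set1 ?mule_ge0// graph_measure1// pE -EFinM EFinD; congr (_ + _)%E.
    rewrite esum_image; last by move=> i i' _ _ [].
    rewrite (eq_esum (b := fun i => if i \in [set cl k] then
      (v k * (lam k - (lam k ^+ kappa)^-1))%:E else 0%E)); last first.
      move=> i _; rewrite -(consistent_branch i (msg k)) branch_nu_atom graph_measure1//= -EFinM.
      have b0 := mass0 (Branch i 0%N); rewrite /= in b0.
      rewrite mulrA mulfV ?gt_eqF// mul1r /branch_mass /in_class.
      have -> : (i \in [set cl k]) = (cl k == i).
        by apply/idP/eqP; rewrite inE /=.
      by case: ifP.
    rewrite -esum_mkcond esum_set1// lee_fin mulr_ge0//.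
      exact: ltW (lam_mass_gt0 _ _).
    exact: ltW (lam_gap_gt0 _ _).
  rewrite graph_measure1//= inver gt_eqF// -EFinM => -[] e.
  rewrite exprS -mulrA -(chain k kappa (ltnSn _)).
  have -> : Circ (Ordinal (ltnSn kappa)) = Circ ord_max :> X.
    by congr Circ; apply: val_inj.
  by rewrite mulrCA -e mulrA mulfV ?gt_eqF// mul1r.
have pv k : circ_total 0 * p k (Circ ord0) = v k * lam k ^+ 0 / lam k ^+ kappa.
  have d0 : lam k ^+ kappa.+1 - 1 != 0 by rewrite subr_eq0 gt_eqF// exprn_egt1.
  apply: (mulfI d0); rewrite mulrBl mul1r -top addrAC subrr add0r expr0 mulr1.
  rewrite exprS; field; rewrite expf_neq0// gt_eqF//.
have : (\sum_(k <oo) (p k (Circ ord0))%:E <= 1)%E.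
  have a0 : 0 < @node_scale R kappa.
    by apply: lt_trans ltr01 _; case/andP: (@node_scale_bounds R kappa).
  apply: le_trans (@probability_le1 _ _ _ (P (Circ ord0)) (\bigcup_k [set lam k]) _); last first.
    exact: bigcupT_measurable.
  rewrite measure_bigcup//; last first.
    by move=> i j _ _ [t [/= -> /(dyadic_inj a0)]].
  rewrite [leRHS](eq_eseriesl (Q := xpredT)); last by move=> k; rewrite in_setT.
  by apply: lee_nneseries => k *; rewrite -pE.
have s := @circ_summable R kappa 0.
rewrite (eq_eseriesr (g := fun k => ((circ_total 0)^-1%:E * (v k * lam k ^+ 0 / lam k ^+ kappa)%:E)%E)).
  rewrite nneseriesZl; last by move=> k _; rewrite lee_fin s.1.
  rewrite nnsumE// -EFinM lee_fin ler_pdivrMl// mulr1.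
  by apply/negP; rewrite -ltNge /circ_total ltrBlDr ltrDl ltr01.
by move=> k _; rewrite -EFinM -pv mulKf// gt_eqF.
Qed.

End no_consistent_family.

(** * Existence of the graph measure *)

(** For finitely many branches, residues modulo their number; otherwise one node
    per branch. *)
Lemma alternating_classes (eta : option nat)
    (heta : forall k : nat, eta = Some k -> (2 <= k)%N) :
  exists cl : nat -> branch_index eta,
    (forall i, exists k, cl k = i) /\ (forall k, cl k != cl k.+1).
Proof.
case: eta heta => [e|] heta.
  have e2 : (1 < e)%N by exact: heta.
  have lt k : (k %% e < e)%N by rewrite ltn_mod ltnW.
  exists (fun k => exist _ (k %% e)%N (lt k) : branch_index (Some e)); split.
    move=> [i hi]; exists i; apply: val_inj => /=; rewrite modn_small//.
  move=> k; rewrite -val_eqE/= eq_sym -addn1 -[X in _ != X %[mod _]]addn0.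
  by rewrite eqn_modDl mod0n modn_small.
exists (fun k => exist _ k isT : branch_index None); split.
  by move=> [i hi]; exists i; apply: val_inj.
by move=> k; rewrite -val_eqE/= neq_ltn leqnn.
Qed.

Theorem theorem5p4p1 (R : realType) (kappa : nat) (eta : option nat)
    (heta : forall k : nat, eta = Some k -> (2 <= k)%N) :
  exists mu : {measure set (vertex kappa eta) -> \bar R},
    discrete_measure mu /\
    dense_in_L2 mu (dom_infty mu (composition_operator mu)) /\
    (* (i) *)
    (stieltjes_moment_sequence (hseq mu (Circ ord_max)) /\
     H_determinate (hseq mu (Circ ord_max)) /\
     sequence_index (hseq mu (Circ ord_max)) 0 0%E) /\
    (* (ii) *)
    ((forall (i : branch_index eta) (j : nat),
       stieltjes_moment_sequence (hseq mu (Branch i j)) /\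
       H_determinate (hseq mu (Branch i j)) /\
       infinite_index (hseq mu (Branch i j))) /\
     (forall i : branch_index eta,
       stieltjes_moment_sequence (hseq mu (Branch i 0)))) /\
    (* (iii) *)
    (exists P : branch_index eta -> probability (measurableTypeR R) R,
       [/\ family_bcd' mu P,
           (forall P' : branch_index eta -> probability (measurableTypeR R) R,
              family_bcd' mu P' -> forall i, measure_eq (P i) (P' i))
         & ~ cond_d mu P]) /\
    (* (iv) *)
    ~ (exists P' : vertex kappa eta -> probability (measurableTypeR R) R,
         (forall x, supported_on_Rplus (P' x)) /\
         consistency_condition mu P') /\
    (* (v) *)
    (kappa = 0%N -> generates_stieltjes mu (composition_operator mu)).
Proof.
have [cl [cl_surj cl_alt]] := alternating_classes heta.
have fin := @graph_measure_fin R kappa eta cl cl_surj.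
have branch := @hseq_Branch_props R kappa eta cl cl_surj cl_alt.
have [circ_S circ_det circ_index] := @hseq_Circ_max_props R kappa eta cl cl_surj.
have branch_S i j : stieltjes_moment_sequence (hseq (@graph_measure R kappa eta cl) (Branch i j)).
  by exists (@branch_nu R kappa eta cl i j); exact: (branch i j).1.
exists (graph_measure kappa cl); split; first exact: vertex_measure_discrete (graph_mass_gt0 cl_surj).
split; first exact: dense_dom_infty.
split; first by [].
split.
  split=> [i j|i]; last exact: branch_S.
  by split; [exact: branch_S|exact: (branch i j).2].
split.
  exists (branch_prob kappa cl_surj); split.
  - exact: branch_prob_family.
  - move=> P' [_ bP' _ _] i.
    have [[fm _ rep] _] := bP' i.
    have [[fm' _ rep'] [det _]] := branch i 0%N.
    exact: (H_determinate_unique det (conj fm' rep') (conj fm rep)).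
  - exact: branch_prob_not_d.
split.
  by move=> [P' [supp cc]]; exact: no_consistent_family cl_surj cl_alt _ supp cc.
move=> k0; apply: generates_stieltjes_of_hseq => // [x|[r|i j]].
- exact: graph_mass_gt0.
- suff -> : r = ord_max by [].
  by apply: val_inj => /=; have := ltn_ord r; lia.
- exact: branch_S.
Qed.
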